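(* Suppose there exist an absolute constant $c>0$ and $t\in[0,1]$ such that $k_m\le c\,m^{t}$ for all $m$ large enough. (1) Let $f_*\in\mathcal{C}_L(\Omega)$. For all $\varepsilon>0$, for all $m$ large enough, $$\inf_{f\in\mathcal{F}_{m,k_m}}\|f-f_*\|_\infty\ \ge\ c_{d,L,\Omega}\, m^{-2(1+t)/d-\varepsilon}.$$ (2) Let $K_*\in\mathcal{K}(\Gamma)$. For all $\varepsilon>0$, for all $m$ large enough, $$\inf_{S\in\mathcal{L}(\mathcal{S}_{m,k_m})} d_H(S,K_* )\ \ge\ c_{d,\Gamma}\, m^{-2(1+t)/(d-1)-\varepsilon}.$$
   Context: For positive integers $m,k$ with $k$ dividing $m$, $\mathbb{S}^m_k$ is the set of $m\times m$ real symmetric matrices that are block diagonal with blocks of size at most $k\times k$. A function $f:\mathbb{R}^d\to\mathbb{R}$ is $(m,k)$-spectrahedral if $f(x)=\lambda_{\max}\left(\sum_{i=1}^d x_iA_i+B\right)$ for some $A_1,\dots,A_d,B\in\mathbb{S}^m_k$, where $\lambda_{\max}$ is the largest eigenvalue. $\mathcal{F}_{m,k}$ is the class of $(m,k)$-spectrahedral functions. For each $m$, $k_m$ is a positive integer dividing $m$. $\Omega\subset\mathbb{R}^d$ is a compact, convex, full-dimensional set, $L>0$, and $\mathcal{C}_L(\Omega)$ is the class of $L$-Lipschitz convex functions with support (domain) $\Omega$. $\|\cdot\|_\infty$ is the sup norm, so $\|f-f_*\|_\infty=\sup_{x\in\Omega}|f(x)-f_*(x)|$. The $(m,k)$-spectraplex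 is $\mathcal{S}_{m,k}=\{M\in\mathbb{S}^m_k:\mathrm{tr}(M)=1,\ M\succeq 0\}$, and $\mathcal{L}(\mathcal{S}_{m,k})$ is the collection of linear images of $\mathcal{S}_{m,k}$ in $\mathbb{R}^d$ (called $(m,k)$-spectratopes). For $\Gamma\in(0,\infty)$, $\mathcal{K}(\Gamma)$ is the collection of compact convex subsets of $\mathbb{R}^d$ contained in the Euclidean ball $B_d(0,\Gamma)$ of radius $\Gamma$ centered at $0$. For compact convex sets $S,K$, with support functions $h_K(u)=\sup_{x\in K}\langle u,x\rangle$ for $u$ in the unit sphere $\mathbb{S}^{d-1}$, $d_H(S,K)=\|h_S-h_K\|_\infty=\sup_{u\in\mathbb{S}^{d-1}}|h_S(u)-h_K(u)|$ is the Hausdorff distance. $c_{d,L,\Omega}$ and $c_{d,\Gamma}$ denote positive constants depending only on the quantities in their subscripts.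
   Formalization: The bounds fail for every f_* and K_* (f_*=0 and K_*={0} are represented exactly); the formal claim is that, given k_m, c, t, some f_* in C_L(Ω) (respectively some K_* in K(Γ), with d≥2) satisfies the bound for all ε>0 and all m large enough. *)

(* Defs.v *)
From HB Require Import structures.
From mathcomp Require Import all_boot all_order all_algebra.
From mathcomp Require Import all_classical all_reals all_analysis.

Set Implicit Arguments.
Unset Strict Implicit.
Unset Printing Implicit Defensive.

Import Order.TTheory GRing.Theory Num.Theory.
Import numFieldNormedType.Exports.

Local Open Scope classical_set_scope.
Local Open Scope ring_scope.

Section Euclidean.
Context {R : realType}.

Definition dotrv d (x y : 'rV[R]_d) : R := \sum_(i < d) x 0 i * y 0 i.

(* The library norm on 'rV[R]_d is the maximum norm; only its topology, which
   is the Euclidean one, is used below. *)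
Definition enorm d (x : 'rV[R]_d) : R := Num.sqrt (dotrv x x).

Definition esphere d : set 'rV[R]_d := [set u | enorm u = 1].

(* Extended-real valued, so that an unbounded g has norm +oo and not the
   default value of sup. *)
Definition supnorm (T : Type) (D : set T) (g : T -> R) : \bar R :=
  ereal_sup [set `|g x|%:E | x in D].

End Euclidean.

Section Spectrahedral.
Context {R : realType}.

(* S^m_k: with k dividing m, the diagonal is cut into the m / k consecutive
   blocks of indices with the same quotient by k. Matrices with finer blocks
   inside these are included. *)
Definition symblock (m k : nat) : set 'M[R]_m :=
  [set A | A^T = A /\ forall i j : 'I_m, (i %/ k != j %/ k)%N -> A i j = 0].

Definition lambda_max (m : nat) (A : 'M[R]_m) : R :=
  sup [set a | eigenvalue A a].

Definition spectrahedral d (m k : nat) : set ('rV[R]_d -> R) :=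
  [set f : 'rV[R]_d -> R | exists (A : 'I_d -> 'M[R]_m) (B : 'M[R]_m),
     [/\ forall i, symblock k (A i), symblock k B &
         forall x : 'rV[R]_d, f x = lambda_max (\sum_(i < d) x 0 i *: A i + B)]].

Definition lipschitz_convex (d : nat) (L : R) (Omega : set 'rV[R]_d) :
    set ('rV[R]_d -> R) :=
  [set f | convex_function Omega f /\
     {in Omega &, forall x y, `|f x - f y| <= L * enorm (x - y)}].

Definition psd (m : nat) (M : 'M[R]_m) : Prop :=
  M^T = M /\ forall v : 'rV[R]_m, 0 <= (v *m M *m v^T) 0 0.

Definition spectraplex (m k : nat) : set 'M[R]_m :=
  [set M | [/\ symblock k M, \tr M = 1 & psd M]].

(* Every linear map defined on symmetric block diagonal matrices extends to
   'M[R]_m, so the latter may serve as the domain. *)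
Definition spectratope d (m k : nat) : set (set 'rV[R]_d) :=
  [set S | exists g : {linear 'M[R]_m -> 'rV[R]_d}, S = g @` spectraplex k].

(* Nonemptiness is what makes the support function finite. *)
Definition convex_body (d : nat) (Gamma : R) : set (set 'rV[R]_d) :=
  [set K : set 'rV[R]_d | [/\ K !=set0, compact K, convex_set K &
                            forall x, K x -> enorm x <= Gamma]].

Definition support_function (d : nat) (K : set 'rV[R]_d) (u : 'rV[R]_d) : R :=
  sup [set dotrv u x | x in K].

Definition hausdorff_dist (d : nat) (S K : set 'rV[R]_d) : \bar R :=
  supnorm (esphere (d := d))
    (fun u => support_function S u - support_function K u).

Definition block_growth (k : nat -> nat) (c t : R) : Prop :=
  [/\ forall m, (0 < m)%N -> (0 < k m)%N /\ (k m %| m)%N,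
      0 < c, 0 <= t <= 1 &
      \forall m \near \oo, (k m)%:R <= c * m%:R `^ t].

End Spectrahedral.

(* Main.v *)
Require Import Defs.
From HB Require Import structures.
From mathcomp Require Import all_boot all_order all_algebra.
From mathcomp Require Import all_classical all_reals all_analysis.
From mathcomp Require Import ring lra.

Set Implicit Arguments.
Unset Strict Implicit.
Unset Printing Implicit Defensive.

Import Order.TTheory GRing.Theory Num.Theory.
Import numFieldNormedType.Exports.

Local Open Scope classical_set_scope.
Local Open Scope ring_scope.

(** The proof compares the number of parameters of the approximating class with
    the richness of the class to be approximated.

    On the side of the target, [envelope kap P] is the supremum of the tangents
    at the points of a set [P] to the paraboloid [kap |y|^2]; it equals
    [kap (|y|^2 - dist (y, P)^2)] by [tangentE]. For a grid of [g^n] points with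
    spacing [s], each of the [2^(g^n)] selections of grid points gives such a
    function, and two selections can be told apart from the values on the grid
    up to errors of order [s^2].

    On the side of the approximation, only the statements that [a - A(y)] is
    semidefinite matter, where [A(y)] is a pencil of symmetric block diagonal
    matrices: they define the sublevel sets of the largest eigenvalue
    ([lambda_max_le]) and, for spectratopes, of the support function in an affine
    chart of the sphere ([spectratope_pencil]). A pencil with [m k] entries per
    coefficient would have about [m k log m] bits after rounding, but a good
    approximation does not bound its coefficients, since very negative
    eigenvalues are invisible. A congruence by a Cholesky factor with the same
    blocks makes them bounded ([normalize]). Evaluating slightly closer to the
    origin than the grid points makes the tests robust ([dichotomy]). So the
    rounded normal form determines the selection, and when [g^n] exceeds about
    [m k log m] some selection is missed by all pencils of that size
    ([missed_selection]). With [k] at most [c m^t] this happens at a spacing of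
    [m^(-(1 + t) / n)] up to logarithms, which yields the error
    [m^(-2 (1 + t) / n)] up to logarithms, hence the exponent with [eps].

    For one target to be hard for all large [m], level [i] is responsible for the
    [m] between [2^i] and [2^(i+1)]. The levels occupy disjoint cubes along a
    diagonal, of width about [i^-2], which again costs only logarithms
    ([hard_envelope]).

    In the first part the target is the envelope itself, in dimension [n = d].
    In the second part [n = d - 1], and the target is the body of the bounded
    affine functions below the envelope: its support function in the directions
    [(1, y)] is the envelope. *)

(** * Quadratic forms and Cholesky factors *)

Section QuadraticForms.
Context {R : realType}.
Implicit Types (m n : nat).

Lemma dotrvC n (x y : 'rV[R]_n) : dotrv x y = dotrv y x.
Proof. by apply: eq_bigr => i _; rewrite mulrC. Qed.

Lemma dotrvDl n (x y z : 'rV[R]_n) : dotrv (x + y) z = dotrv x z + dotrv y z.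
Proof. by rewrite -big_split /=; apply: eq_bigr => i _; rewrite mxE mulrDl. Qed.

Lemma dotrvZl n a (x y : 'rV[R]_n) : dotrv (a *: x) y = a * dotrv x y.
Proof. by rewrite mulr_sumr; apply: eq_bigr => i _; rewrite mxE mulrA. Qed.

Lemma dotrvDr n (x y z : 'rV[R]_n) : dotrv x (y + z) = dotrv x y + dotrv x z.
Proof. by rewrite dotrvC dotrvDl !(dotrvC x). Qed.

Lemma dotrvZr n a (x y : 'rV[R]_n) : dotrv x (a *: y) = a * dotrv x y.
Proof. by rewrite dotrvC dotrvZl dotrvC. Qed.

Lemma dotrvBr n (x y z : 'rV[R]_n) : dotrv x (y - z) = dotrv x y - dotrv x z.
Proof. by rewrite -scaleN1r dotrvDr dotrvZr mulN1r. Qed.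

Lemma dotrv_ge0 n (x : 'rV[R]_n) : 0 <= dotrv x x.
Proof. by apply: sumr_ge0 => i _; rewrite -expr2 sqr_ge0. Qed.

Lemma sqr_coord_le n (x : 'rV[R]_n) i : x 0 i ^+ 2 <= dotrv x x.
Proof.
rewrite /dotrv (bigD1 i) //= -expr2 lerDl.
by apply: sumr_ge0 => j _; rewrite -expr2 sqr_ge0.
Qed.

Lemma dotrv_eq0 n (x : 'rV[R]_n) : (dotrv x x == 0) = (x == 0).
Proof.
apply/eqP/eqP => [x0|->]; last first.
  by rewrite /dotrv big1 // => i _; rewrite mxE mul0r.
apply/rowP => i; rewrite mxE; apply/eqP; rewrite -sqrf_eq0 eq_le sqr_ge0 andbT.
by rewrite -x0 sqr_coord_le.
Qed.

Lemma dotrv_gt0 n (x : 'rV[R]_n) : x != 0 -> 0 < dotrv x x.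
Proof. by move=> x0; rewrite lt_neqAle eq_sym dotrv_eq0 x0 dotrv_ge0. Qed.

Lemma dotrv_mulmx n (x y : 'rV[R]_n) : dotrv x y = (x *m y^T) 0 0.
Proof. by rewrite mxE; apply: eq_bigr => i _; rewrite mxE. Qed.

Definition qform m (A : 'M[R]_m) (v : 'rV[R]_m) : R := (v *m A *m v^T) 0 0.

Lemma qformE m (A : 'M[R]_m) v :
  qform A v = \sum_i \sum_j v 0 i * A i j * v 0 j.
Proof.
rewrite /qform mxE exchange_big /=; apply: eq_bigr => j _.
by rewrite !mxE mulr_suml.
Qed.

Lemma qformD m (A B : 'M[R]_m) v : qform (A + B) v = qform A v + qform B v.
Proof. by rewrite /qform mulmxDr mulmxDl mxE. Qed.

Lemma qformZ m a (A : 'M[R]_m) v : qform (a *: A) v = a * qform A v.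
Proof. by rewrite /qform -scalemxAr -scalemxAl mxE. Qed.

Lemma qformB m (A B : 'M[R]_m) v : qform (A - B) v = qform A v - qform B v.
Proof. by rewrite -scaleN1r qformD qformZ mulN1r. Qed.

Lemma qform_sum m n (a : 'I_n -> R) (A : 'I_n -> 'M[R]_m) v :
  qform (\sum_i a i *: A i) v = \sum_i a i * qform (A i) v.
Proof.
rewrite /qform mulmx_sumr mulmx_suml summxE; apply: eq_bigr => i _.
exact: qformZ.
Qed.

Lemma qform_scalar m a (v : 'rV[R]_m) : qform a%:M v = a * dotrv v v.
Proof. by rewrite /qform mul_mx_scalar -scalemxAl mxE dotrv_mulmx. Qed.

Lemma qform1 m (v : 'rV[R]_m) : qform 1%:M v = dotrv v v.
Proof. by rewrite qform_scalar mul1r. Qed.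

Lemma qform_congr m (T A : 'M[R]_m) v :
  qform (T *m A *m T^T) v = qform A (v *m T).
Proof. by rewrite /qform trmx_mul !mulmxA. Qed.

Lemma qform_scale m (A : 'M[R]_m) a v : qform A (a *: v) = a ^+ 2 * qform A v.
Proof.
by rewrite /qform linearZ /= -!scalemxAl -scalemxAr !mxE mulrA expr2.
Qed.

(** Polarization, which recovers the entries of a symmetric matrix from its
    quadratic form. *)
Lemma qformD_vec m (A : 'M[R]_m) u v : A^T = A ->
  qform A (u + v) = qform A u + qform A v + 2 * (u *m A *m v^T) 0 0.
Proof.
move=> As; rewrite /qform linearD /= !mulmxDl !mulmxDr !mxE.
have -> : \sum_j (v *m A) 0 j * u^T j 0 = \sum_j (u *m A) 0 j * v^T j 0.
  have : (v *m A *m u^T)^T = u *m A *m v^T by rewrite !trmx_mul trmxK As mulmxA.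
  by move=> /(congr1 (fun M : 'M[R]_1 => M 0 0)); rewrite !mxE.
ring.
Qed.

Lemma entryE m (A : 'M[R]_m) i j :
  ((delta_mx 0 i : 'rV[R]_m) *m A *m (delta_mx 0 j : 'rV[R]_m)^T) 0 0 = A i j.
Proof.
rewrite -rowE mxE (bigD1 j) //= !mxE !eqxx mulr1 big1 ?addr0 // => l lj.
by rewrite !mxE (negbTE lj) andbF mulr0.
Qed.

Lemma dotrv_delta m (i : 'I_m) (v : 'rV[R]_m) : dotrv (delta_mx 0 i) v = v 0 i.
Proof.
rewrite /dotrv (bigD1 i) //= mxE !eqxx mul1r big1 ?addr0 // => j ji.
by rewrite mxE (negbTE ji) andbF mul0r.
Qed.

Lemma entry_le m (A : 'M[R]_m) (tau : R) : A^T = A ->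
  (forall v, `|qform A v| <= tau * dotrv v v) -> forall i j, `|A i j| <= tau.
Proof.
move=> As bA i j; pose e i : 'rV[R]_m := delta_mx 0 i.
have Aij : (e i *m A *m (e j)^T) 0 0 = A i j by exact: entryE.
have dd l : dotrv (e l) (e l) = 1 by rewrite dotrv_delta mxE !eqxx.
have := bA (e i + e j); have := bA (e i + -1 *: e j).
have Nij : (e i *m A *m (-1 *: e j)^T) 0 0 = - A i j.
  by rewrite linearZ /= -scalemxAr mxE Aij mulN1r.
rewrite !qformD_vec // qform_scale Aij Nij.
rewrite !(dotrvDl, dotrvDr, dotrvZl, dotrvZr) !dd !mulN1r sqrrN expr1n.
rewrite (dotrvC (e j)) !ler_norml => /andP[h1 h2] /andP[h3 h4]; lra.
Qed.

(** Small entries give a small form: a bilinear term is at most the mean of the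
    two squares. *)
Lemma qform_le m (A : 'M[R]_m) (eta : R) v : (forall i j, `|A i j| <= eta) ->
  `|qform A v| <= eta * m%:R * dotrv v v.
Proof.
move=> bA; rewrite qformE.
have b i j : `|v 0 i * A i j * v 0 j| <= eta * ((v 0 i ^+ 2 + v 0 j ^+ 2) / 2).
  rewrite mulrAC normrM mulrC ler_pM // normrM.
  have := sqr_ge0 (`|v 0 i| - `|v 0 j|).
  rewrite sqrrB !real_normK ?num_real //; lra.
apply: (le_trans (ler_norm_sum _ _ _)).
apply: (@le_trans _ _
   (\sum_(i < m) \sum_(j < m) eta * ((v 0 i ^+ 2 + v 0 j ^+ 2) / 2))).
  apply: ler_sum => i _; apply: (le_trans (ler_norm_sum _ _ _)).
  by apply: ler_sum.
have s (x : R) : \sum_(i < m) x = m%:R * x.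
  by rewrite sumr_const card_ord mulr_natl.
have dE : dotrv v v = \sum_i v 0 i ^+ 2 by apply: eq_bigr => i _; rewrite expr2.
rewrite (eq_bigr (fun i => eta / 2 * (m%:R * v 0 i ^+ 2 + dotrv v v))).
  by rewrite -mulr_sumr big_split /= -mulr_sumr -dE s; lra.
move=> i _; rewrite dE -mulr_sumr -mulr_suml big_split /= s; ring.
Qed.

Definition psd_form m (A : 'M[R]_m) := forall v, 0 <= qform A v.

(** Congruence by Cholesky elimination. Eliminating the first coordinate only
    combines rows with index in the same class of [e], which is why the factor
    inherits the block structure recorded by [e]. *)
Lemma cholesky m (e : rel 'I_m) (A : 'M[R]_m) :
  equivalence_rel e -> A^T = A -> (forall i j, ~~ e i j -> A i j = 0) ->
  (forall v : 'rV[R]_m, v != 0 -> 0 < qform A v) ->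
  exists2 T : 'M[R]_m, T *m A *m T^T = 1%:M & forall i j, ~~ e i j -> T i j = 0.
Proof.
elim: m => [|m IH] in e A * => ee As eA pA.
  by exists 0 => [|[]//]; rewrite flatmx0 [RHS]flatmx0.
have er i : e i i by have [] := ee i i i.
have es i j : e i j = e j i.
  apply/idP/idP => eij.
    by have [_ /(_ eij)] := ee i j i; rewrite er => <-.
  by have [_ /(_ eij)] := ee j i j; rewrite er => <-.
have et i j l : e i j -> e j l -> e i l.
  by move=> eij; have [_ /(_ eij) ->] := ee i j l.
pose a := A 0 0.
have a0 : 0 < a.
  have := pA (delta_mx 0 0); rewrite /qform entryE.
  apply; apply/eqP => /matrixP/(_ 0 0)/eqP.
  by rewrite !mxE !eqxx oner_eq0.
pose A' : 'M[R]_(1 + m) := A.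
pose b := ursubmx A'; pose D := drsubmx A'.
have A'E : A' = block_mx a%:M b b^T D.
  rewrite -[LHS]submxK; congr block_mx.
    apply/matrixP => i j; rewrite !ord1 !mxE /= /a.
    by congr (A _ _); apply/val_inj.
  by rewrite -[in LHS](_ : A'^T = A') // trmx_ursub.
have DE : D^T = D by rewrite trmx_drsub (_ : A'^T = A').
pose E : 'M[R]_(1 + m) := block_mx 1%:M 0 (- a^-1 *: b^T) 1%:M.
pose S := D - a^-1 *: (b^T *m b).
have EAE : E *m A' *m E^T = block_mx a%:M 0 0 S.
  rewrite A'E /E tr_block_mx !mulmx_block !(trmx1, trmx0, linearZ, trmxK) /=.
  rewrite !(mul1mx, mulmx1, mul0mx, mulmx0, addr0, add0r).
  rewrite !mul_scalar_mx !mul_mx_scalar !scalerA !mulrN !divff ?gt_eqF //.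
  rewrite !scaleN1r !addNr mul0mx scaler0 add0r !trmxK mulNr mulVf ?gt_eqF //.
  rewrite scaleN1r addNr.
  by rewrite -scalemxAl addrC scaleNr.
have Eu w : row_mx (0 : 'M[R]_1) w *m E = row_mx (w *m (- a^-1 *: b^T)) w.
  by rewrite mul_row_block !mul0mx !add0r mulmx1.
have qS w : qform S w = qform A' (row_mx 0 w *m E).
  rewrite -qform_congr EAE /qform mul_row_block tr_row_mx mul_row_col.
  by rewrite !(mul0mx, mulmx0, add0r, trmx0).
have S_sym : S^T = S.
  by rewrite /S !(linearB, linearZ) /= DE trmx_mul trmxK.
pose e' : rel 'I_m := fun i j => e (rshift 1 i) (rshift 1 j).
have e'e : equivalence_rel e' by move=> i j l; apply: ee.
pose o0 : 'I_m.+1 := lshift m (ord0 : 'I_1).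
have e0 (i : 'I_m) : ~~ e o0 (rshift 1 i) -> b 0 i = 0.
  by move=> ne; rewrite !mxE eA.
have e'S i j : ~~ e' i j -> S i j = 0.
  move=> ne; rewrite /S !mxE big_ord1 !mxE (eA _ _ ne).
  have [ei|/e0] := boolP (e o0 (rshift 1 i)); last first.
    by rewrite !mxE => ->; rewrite mul0r mulr0 subr0.
  have [ej|/e0] := boolP (e o0 (rshift 1 j)); last first.
    by rewrite !mxE => ->; rewrite !mulr0 subr0.
  by case/negP: ne; apply: et ej; rewrite es.
have pS w : w != 0 -> 0 < qform S w.
  move=> w0; rewrite qS pA // Eu; apply: contraNneq w0.
  move/(congr1 (@rsubmx R 1 1 m)); rewrite row_mxKr => ->.
  by apply/eqP/rowP => l; rewrite !mxE.
have [T' T'S e'T] := IH e' S e'e S_sym e'S pS.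
pose F : 'M[R]_(1 + m) := block_mx (Num.sqrt a)^-1%:M 0 0 T'.
have FSF : F *m block_mx a%:M 0 0 S *m F^T = 1%:M.
  rewrite /F tr_block_mx !mulmx_block.
  rewrite !(trmx0, tr_scalar_mx, mul0mx, mulmx0, addr0, add0r) T'S.
  rewrite -!scalar_mxM mulrAC -invfM -expr2 sqr_sqrtr ?ltW // mulVf ?gt_eqF //.
  by rewrite -scalar_mx_block.
exists (F *m E).
  by rewrite trmx_mul mulmxA -(mulmxA F) -(mulmxA F) EAE FSF.
have FE : F *m E =
    block_mx (Num.sqrt a)^-1%:M 0 (T' *m (- a^-1 *: b^T)) T'.
  by rewrite mulmx_block !(mul0mx, mulmx0, addr0, add0r, mulmx1).
suff supp (i j : 'I_(1 + m)) : ~~ e i j -> (F *m E) i j = 0 by exact: supp.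
rewrite FE -(splitK i) -(splitK j).
case: (fintype.split i) => i'; case: (fintype.split j) => j' /= ne.
- by move: ne; rewrite !ord1 er.
- by rewrite block_mxEur mxE.
- rewrite block_mxEdl mxE big1 // => l _; rewrite !mxE ord1 in ne *.
  have [el|/e0] := boolP (e o0 (rshift 1 l)); last first.
    by rewrite !mxE => ->; rewrite !mulr0.
  rewrite e'T ?mul0r //; apply: contra ne => /et; apply; by rewrite es.
- by rewrite block_mxEdr e'T.
Qed.

End QuadraticForms.

(** * Normal forms of matrix pencils and envelopes of tangents *)

Section Pencils.
Context {R : realType}.
Implicit Types (m n : nat).

Definition supported m (e : rel 'I_m) (A : 'M[R]_m) :=
  forall i j, ~~ e i j -> A i j = 0.

Lemma supportedM m (e : rel 'I_m) (A B : 'M[R]_m) : equivalence_rel e ->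
  supported e A -> supported e B -> supported e (A *m B).
Proof.
move=> ee sA sB i j nij; rewrite mxE big1 // => l _.
have [il|/sA->] := boolP (e i l); last by rewrite mul0r.
rewrite sB ?mulr0 //; apply: contra nij.
by have [_ /(_ il) ->] := ee i l j.
Qed.

Lemma supported_tr m (e : rel 'I_m) (A : 'M[R]_m) : equivalence_rel e ->
  supported e A -> supported e A^T.
Proof.
move=> ee sA i j nij; rewrite mxE sA //; apply: contra nij => ji.
by have [jj /(_ ji) <-] := ee j i j.
Qed.

Definition pencil n m (A0 : 'M[R]_m) (A : 'I_n -> 'M[R]_m) (y : 'rV[R]_n) :=
  \sum_(i < n) y 0 i *: A i + A0.

Lemma qform_pencil n m (A0 : 'M[R]_m) (A : 'I_n -> 'M[R]_m) y v :
  qform (pencil A0 A y) v = \sum_i y 0 i * qform (A i) v + qform A0 v.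
Proof. by rewrite qformD qform_sum. Qed.

(** The value at [v] of the form of the pencil [1 - sum_i y_i C_i - b W]. *)
Definition normal n m (W : 'M[R]_m) (C : 'I_n -> 'M[R]_m) (y : 'rV[R]_n)
    (b : R) (v : 'rV[R]_m) : R :=
  dotrv v v - \sum_i y 0 i * qform (C i) v - b * qform W v.

(** An upper bound on the largest eigenvalue of a pencil near [0] leaves the
    very negative eigenvalues free, so its coefficients need not be bounded.
    The congruence that turns [2 M - A0] into the identity bounds them all: the
    hypotheses say that [A0 +- r A_i <= M], which becomes [-1/r <= C_i <= 1/r].
    The sublevel sets of the largest eigenvalue stay definable. *)
Lemma normalize n m (e : rel 'I_m) (A0 : 'M[R]_m) (A : 'I_n -> 'M[R]_m)
    (M r : R) : equivalence_rel e -> 0 < M -> 0 < r ->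
  A0^T = A0 -> (forall i, (A i)^T = A i) ->
  supported e A0 -> (forall i, supported e (A i)) ->
  (forall v, qform A0 v <= M * dotrv v v) ->
  (forall i v, r * `|qform (A i) v| <= M * dotrv v v - qform A0 v) ->
  exists W C,
  [/\ supported e W /\ forall i, supported e (C i),
      forall i j, `|W i j| <= M^-1,
      forall l i j, `|C l i j| <= r^-1,
      forall v, 0 <= qform W v <= M^-1 * dotrv v v &
      forall (y : 'rV[R]_n) a, psd_form (a%:M - pencil A0 A y) <->
        forall v, 0 <= normal W C y (2 * M - a) v].
Proof.
move=> ee M0 r0 A0s As sA0 sA bA0 bA.
have er i : e i i by have [] := ee i i i.
pose Q := (2 * M)%:M - A0.
have qQ v : qform Q v = 2 * M * dotrv v v - qform A0 v.
  by rewrite qformB qform_scalar.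
have [||v v0|T TQ sT] := @cholesky _ _ e Q ee.
- by rewrite linearB /= tr_scalar_mx A0s.
- move=> i j nij; rewrite !mxE sA0 // subr0; case: eqP nij => [->|//].
  by rewrite er.
- rewrite qQ; have := bA0 v; have := dotrv_gt0 v0.
  by nra.
have dT v : dotrv v v = 2 * M * dotrv (v *m T) (v *m T) - qform A0 (v *m T).
  by rewrite -qQ -qform_congr TQ qform1.
have qW v : qform (T *m T^T) v = dotrv (v *m T) (v *m T).
  by rewrite -[T in T *m _]mulmx1 qform_congr qform1.
have Wb v : 0 <= qform (T *m T^T) v <= M^-1 * dotrv v v.
  rewrite qW dotrv_ge0 /= ler_pdivlMl // (dT v).
  have := bA0 (v *m T); nra.
have TU : T \in unitmx by have := TQ; rewrite -mulmxA => /mulmx1_unit[].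
exists (T *m T^T), (fun i => T *m A i *m T^T); split => //.
- have sTt := supported_tr ee sT.
  by split => [|i]; do ?apply: supportedM.
- apply: entry_le => [|v]; first by rewrite trmx_mul trmxK.
  by case/andP: (Wb v) => w0 ?; rewrite ger0_norm.
- move=> l; apply: entry_le => [|v].
    by rewrite !trmx_mul trmxK As mulmxA.
  rewrite qform_congr ler_pdivlMl // (le_trans (bA _ _)) // (dT v).
  have := dotrv_ge0 (v *m T); nra.
- move=> y a.
  have nE v : normal (T *m T^T) (fun i => T *m A i *m T^T) y (2 * M - a) v =
              qform (a%:M - pencil A0 A y) (v *m T).
    rewrite /normal (dT v) qW qformB qform_scalar qform_pencil.
    by under eq_bigr do rewrite qform_congr; ring.
  split => [h v|h v]; first by rewrite nE.
  by have := h (v *m invmx T); rewrite nE mulmxKV.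
Qed.

Definition tangent n (kap : R) (z y : 'rV[R]_n) : R :=
  kap * (2 * dotrv z y - dotrv z z).

(** The supremum of the tangents at the points of [P] to the paraboloid
    [kap |y|^2]. By [tangentE] it equals [kap (|y|^2 - dist (y, P)^2)]. *)
Definition envelope n (kap : R) (P : set 'rV[R]_n) (y : 'rV[R]_n) : R :=
  sup [set tangent kap z y | z in P].

Lemma tangentE n kap (z y : 'rV[R]_n) :
  tangent kap z y = kap * dotrv y y - kap * dotrv (y - z) (y - z).
Proof.
rewrite /tangent !dotrvBr (dotrvC (y - z) y) (dotrvC (y - z) z) !dotrvBr.
by rewrite (dotrvC y z); ring.
Qed.

Lemma envelope_le n kap (P : set 'rV[R]_n) y b : P !=set0 ->
  (forall z, P z -> tangent kap z y <= b) -> envelope kap P y <= b.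
Proof.
move=> P0 h; apply: ge_sup; first exact: image_nonempty.
by move=> _ [z Pz <-]; exact: h.
Qed.

Lemma le_envelope n kap (P : set 'rV[R]_n) y z : 0 <= kap ->
  P z -> tangent kap z y <= envelope kap P y.
Proof.
move=> k0 Pz; apply: ub_le_sup; last by exists z.
exists (kap * dotrv y y) => _ [x _ <-].
by rewrite tangentE gerBl mulr_ge0 // dotrv_ge0.
Qed.

Definition cube n (r : R) : set 'rV[R]_n := [set y | forall i, `|y 0 i| <= r].

Lemma dotrv_cube n r (y : 'rV[R]_n) : cube r y -> dotrv y y <= n%:R * r ^+ 2.
Proof.
move=> yr; apply: (@le_trans _ _ (\sum_(i < n) r ^+ 2)); last first.
  by rewrite sumr_const card_ord mulr_natl.
apply: ler_sum => i _; have := yr i; rewrite -expr2 ler_norml => /andP[? ?]; nra.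
Qed.

(** Closeness up to [del] of [F] and the largest eigenvalue of the pencil,
    phrased with semidefiniteness only so that it applies to eigenvalues and to
    support functions alike. *)
Definition approximates n m (A0 : 'M[R]_m) (A : 'I_n -> 'M[R]_m)
    (F : 'rV[R]_n -> R) (r del : R) :=
  forall y, cube r y -> psd_form ((F y + del)%:M - pencil A0 A y) /\
    forall a, psd_form (a%:M - pencil A0 A y) -> F y - del <= a.

(** A pencil that follows the envelope of [P] tells the points of [P] from the
    points at distance at least [s] from [P]: at the former the envelope is
    [kap |y|^2], at the latter at most [kap |y|^2 - kap s^2], and the level in
    the middle is tested. Moving the test point from [y] to [(1 - th) y] mixes
    in the positive definite value at the origin, which turns semidefiniteness
    into a quantitative gap that small changes of [W] and [C] respect. *)
Lemma dichotomy n m (e : rel 'I_m) (A0 : 'M[R]_m) (A : 'I_n.+1 -> 'M[R]_m)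
    (P : set 'rV[R]_n.+1) (kap r s : R)
    (M := 4 * kap * n.+1%:R * r ^+ 2) (del := kap * s ^+ 2 / 8)
    (th := del / M) :
  equivalence_rel e -> 0 < kap -> 0 < s <= r -> P !=set0 ->
  A0^T = A0 -> (forall i, (A i)^T = A i) ->
  supported e A0 -> (forall i, supported e (A i)) ->
  approximates A0 A (envelope kap P) r del ->
  exists W C,
  [/\ supported e W /\ forall i, supported e (C i),
      forall i j, `|W i j| <= M^-1,
      forall l i j, `|C l i j| <= r^-1 &
      forall y, cube r y ->
        let test := normal W C ((1 - th) *: y)
          (2 * M - (kap * dotrv y y - kap * s ^+ 2 / 2)) in
        (P y -> exists v, test v < 0) /\
        ((forall p, P p -> s ^+ 2 <= dotrv (y - p) (y - p)) ->
          forall v, th / 2 * dotrv v v <= test v)].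
Proof.
move=> ee kap0 /andP[s0 sr] P0 A0s As sA0 sA appr.
have r0 : 0 < r by exact: lt_le_trans sr.
have nr : r ^+ 2 <= n.+1%:R * r ^+ 2.
  by rewrite ler_peMl ?sqr_ge0 // ler1n.
have M0 : 0 < M by rewrite !mulr_gt0 ?exprn_gt0.
have del0 : 0 < del by rewrite /del !mulr_gt0 ?exprn_gt0.
have delM : 32 * del <= M.
  have -> : 32 * del = 4 * kap * s ^+ 2 by rewrite /del; field.
  rewrite /M -(mulrA (4 * kap)) ler_wpM2l ?mulr_ge0 ?(ltW kap0) //.
  by apply: le_trans nr; rewrite ler_sqr ?nnegrE ?(ltW s0) ?(ltW r0).
have thM : th * M = del by rewrite /th divfK ?gt_eqF.
have th0 : 0 < th by rewrite divr_gt0.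
have th1 : th <= 1 by rewrite ler_pdivrMr //; lra.
have phi (y : 'rV[R]_n.+1) : cube r y -> 0 <= kap * dotrv y y <= M / 4.
  move=> yr; rewrite mulr_ge0 ?(ltW kap0) ?dotrv_ge0 //=.
  have -> : M / 4 = kap * (n.+1%:R * r ^+ 2) by rewrite /M; field.
  by rewrite ler_wpM2l ?(ltW kap0) // dotrv_cube.
have envM y : cube r y -> envelope kap P y + del <= M.
  move=> yr; have /andP[p0 p1] := phi y yr.
  have : envelope kap P y <= kap * dotrv y y; last lra.
  apply: envelope_le => // z _.
  by rewrite tangentE gerBl mulr_ge0 ?(ltW kap0) ?dotrv_ge0.
have ub y v : cube r y ->
    \sum_i y 0 i * qform (A i) v + qform A0 v <= M * dotrv v v.
  move=> yr; have [/(_ v)] := appr y yr.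
  rewrite qformB qform_scalar qform_pencil => h _.
  have := envM y yr; have := dotrv_ge0 v; nra.
have bA0 v : qform A0 v <= M * dotrv v v.
  have := ub 0 v; rewrite big1 ?add0r => [|i _]; last by rewrite mxE mul0r.
  by apply=> i; rewrite mxE normr0 ltW.
have bA i v : r * `|qform (A i) v| <= M * dotrv v v - qform A0 v.
  have point c : `|c| <= r -> c * qform (A i) v + qform A0 v <= M * dotrv v v.
    move=> cr; have := ub (c *: delta_mx 0 i) v; rewrite (bigD1 i) //=.
    rewrite big1 ?addr0 => [|j ji]; last first.
      by rewrite !mxE (negbTE ji) andbF mulr0 mul0r.
    rewrite !mxE !eqxx mulr1; apply => j; rewrite !mxE eqxx /=.
    by case: (j == i); rewrite ?mulr1 // mulr0 normr0 (ltW r0).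
  have := point r; have := point (- r).
  rewrite normrN ger0_norm ?(ltW r0) // lexx.
  move=> /(_ isT) h1 /(_ isT) h2.
  by have [q0|q0] := leP 0 (qform (A i) v);
    rewrite ?(ger0_norm q0) ?(ltr0_norm q0); lra.
have [W [C [supp bW bC qW eqv]]] :=
  normalize ee M0 r0 A0s As sA0 sA bA0 bA.
exists W, C; split => // y yr test.
have /andP[phi0 phiM] := phi y yr.
(* In units of [del], the envelope is at least 4 above the tested level at the
   points of [P] and at least 4 below it at the points far from [P]. *)
have s2 : kap * s ^+ 2 / 2 = 4 * del by rewrite /del; field.
set z := (1 - th) *: y in test *.
have zr : cube r z.
  move=> i; rewrite !mxE normrM (le_trans _ (yr i)) // ler_piMl //.
  by rewrite ger0_norm; lra.
split => [Py|far v].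
  apply: contrapT => /forallNP nneg.
  have {nneg} /eqv /(proj2 (appr z zr)) : forall v, 0 <= test v.
    by move=> v; rewrite leNgt; apply/negP.
  have := le_envelope z (ltW kap0) Py.
  have -> : tangent kap y z = kap * dotrv y y - 2 * (th * (kap * dotrv y y)).
    by rewrite /tangent /z dotrvZr; ring.
  have : th * (kap * dotrv y y) <= th * (M / 4) by rewrite ler_wpM2l // ltW.
  rewrite s2; nra.
have envy : envelope kap P y <= kap * dotrv y y - 8 * del.
  apply: envelope_le => // p /far sp; rewrite tangentE lerD2l lerN2.
  have -> : 8 * del = kap * s ^+ 2 by rewrite /del; field.
  by rewrite ler_wpM2l // ltW.
have := (eqv y _).1 (proj1 (appr y yr)) v.
rewrite /test /normal /z.
have -> : \sum_i ((1 - th) *: y) 0 i * qform (C i) v =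
          (1 - th) * \sum_i y 0 i * qform (C i) v.
  by rewrite mulr_sumr; apply: eq_bigr => i _; rewrite mxE mulrA.
set X := \sum_i _; set d := dotrv v v; rewrite s2.
have /andP[x0 xd] := qW v; rewrite ler_pdivlMl // in xd.
set x := qform W v in x0 xd *; set b := 2 * M - (_ - 4 * del) => h.
have b1 : 0 <= d - X - (b + 3 * del) * x.
  apply: le_trans h _; rewrite lerD2l lerN2 ler_wpM2r // /b; lra.
have bM : b + 3 * del <= 5 / 2 * M by rewrite /b; lra.
have key : 0 <= (3 * del - th * (b + 3 * del) + th * (M / 2)) * x.
  rewrite mulr_ge0 //.
  have : th * (b + 3 * del) <= th * (5 / 2 * M) by rewrite ler_wpM2l // ltW.
  nra.
have : 0 <= (1 - th) * (d - X - (b + 3 * del) * x) by rewrite mulr_ge0 //; lra.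
have : th * (M * x) <= th * d by rewrite ler_wpM2l // ltW.
nra.
Qed.

End Pencils.

(** * The largest eigenvalue of a symmetric matrix *)

Section Spectral.
Context {R : realType}.
Implicit Types (m n : nat).

Lemma qform_continuous m (A : 'M[R]_m) : continuous (qform A).
Proof.
have -> : qform A = fun v => \sum_i \sum_j v 0 i * A i j * v 0 j.
  by apply: funext => v; rewrite qformE.
apply: (continuous_big add_continuous) => i _.
apply: (continuous_big add_continuous) => j _.
have cM (f g : 'rV[R]_m -> R) :
    continuous f -> continuous g -> continuous (fun v => f v * g v).
  by move=> cf cg v; exact: (continuousM (cf v) (cg v)).
apply: (cM (fun v => v 0 i * A i j)); last exact: coord_continuous.
apply: (cM (fun v => v 0 i) (fun=> A i j)); first exact: coord_continuous.
exact: cst_continuous.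
Qed.

Lemma dotrv_continuous m : continuous (fun v : 'rV[R]_m => dotrv v v).
Proof.
have -> : (fun v : 'rV[R]_m => dotrv v v) = qform 1%:M.
  by apply: funext => v; rewrite qform1.
exact: qform_continuous.
Qed.

(** The form is nonnegative at [v - c v Q] for all [c], where its first order
    term in [c] is [- 2 c |v Q|^2]. *)
Lemma psd_form_ker m (Q : 'M[R]_m) v : Q^T = Q -> psd_form Q ->
  qform Q v = 0 -> v *m Q = 0.
Proof.
move=> Qs Q0 qv; apply: contrapT => /eqP /dotrv_gt0; set w := v *m Q => D0.
pose q := qform Q w; have q0 : 0 <= q by exact: Q0.
have := Q0 (v + (- (dotrv w w / (q + 1))) *: w).
have Zt a : (v *m Q *m (a *: w)^T) 0 0 = a * (v *m Q *m w^T) 0 0.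
  by rewrite linearZ /= -scalemxAr mxE.
rewrite qformD_vec // qv add0r qform_scale Zt mulNr.
rewrite -dotrv_mulmx -/w -/q; set D := dotrv w w in D0 *.
have -> : (- (D / (q + 1))) ^+ 2 * q + 2 * - (D / (q + 1) * D) =
          (D / (q + 1)) ^+ 2 * (- q - 2).
  by field; rewrite gt_eqF //; lra.
rewrite pmulr_rge0; last by rewrite exprn_gt0 // divr_gt0 //; lra.
lra.
Qed.

Lemma eigenvalue_le m (A : 'M[R]_m) a b :
  psd_form (a%:M - A) -> eigenvalue A b -> b <= a.
Proof.
move=> psd /eigenvalueP[v vA v0]; have := psd v.
rewrite qformB qform_scalar /qform vA -scalemxAl mxE -dotrv_mulmx -mulrBl.
by rewrite pmulr_lge0 ?subr_ge0 // dotrv_gt0.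
Qed.

(** The Rayleigh quotient of a symmetric matrix attains its maximum on the unit
    sphere, and a maximizer is an eigenvector because a semidefinite form
    vanishes only on the kernel. *)
Lemma max_eigenvalue m (A : 'M[R]_m.+1) : A^T = A ->
  exists2 s, eigenvalue A s & psd_form (s%:M - A).
Proof.
move=> As; pose S := [set v : 'rV[R]_m.+1 | dotrv v v = 1].
have S0 : S !=set0.
  by exists (delta_mx 0 0); rewrite /S /= dotrv_delta mxE !eqxx.
have cbox : compact [set v : 'rV[R]_m.+1 | forall i, v ord0 i \in `[-1, 1]].
  apply: (@rV_compact R m.+1 (fun=> `[(-1 : R), 1]%classic)) => i.
  exact: segment_compact.
have cS : compact S.
  apply: (@subclosed_compact _ _
    [set v : 'rV[R]_m.+1 | forall i, v ord0 i \in `[-1, 1]]).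
  - apply: (@preimage_closed _ _ (fun v : 'rV[R]_m.+1 => dotrv v v)
             [set x : R | x = 1]).
      by move=> x _; exact: dotrv_continuous.
    exact: closed_eq.
  - exact: cbox.
  - move=> v /= v1 i; rewrite in_itv /= -ler_norml -(@ler_pXn2r _ 2) ?nnegrE //.
    by rewrite expr1n real_normK ?num_real // -v1 sqr_coord_le.
have [c cS1 cmax] :
    exists2 c, c \in S & forall t, t \in S -> qform A t <= qform A c.
  apply: EVT_max_rV => //; apply: continuous_subspaceT.
  exact: qform_continuous.
rewrite inE in cS1; pose s := qform A c.
have ps : psd_form (s%:M - A).
  move=> v; rewrite qformB qform_scalar subr_ge0.
  have [->|v0] := eqVneq v 0.
    by rewrite /qform !mul0mx mxE /dotrv big1 ?mulr0 // => i _; rewrite mxE mul0r.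
  have d0 := dotrv_gt0 v0; pose t := (Num.sqrt (dotrv v v))^-1.
  have t2 : t ^+ 2 * dotrv v v = 1.
    by rewrite exprVn sqr_sqrtr ?ltW // mulVf // gt_eqF.
  have := cmax (t *: v); rewrite inE /S /= dotrvZl dotrvZr mulrA -expr2 t2.
  move=> /(_ erefl); rewrite qform_scale -/s => h.
  have t20 : 0 < t ^+ 2 by rewrite exprn_gt0 // invr_gt0 sqrtr_gt0.
  by rewrite -(ler_pM2l t20) mulrCA t2 mulr1.
exists s => //; apply/eigenvalueP; exists c; last first.
  rewrite -dotrv_eq0 (_ : dotrv c c = 1) ?oner_eq0 //; exact: cS1.
have : c *m (s%:M - A) = 0.
  apply: psd_form_ker => //; first by rewrite linearB /= tr_scalar_mx As.
  by rewrite qformB qform_scalar (_ : dotrv c c = 1) ?mulr1 ?subrr //; exact: cS1.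
by rewrite mulmxBr mul_mx_scalar => /eqP; rewrite subr_eq0 => /eqP.
Qed.

Lemma lambda_max_le m (A : 'M[R]_m.+1) a : A^T = A ->
  lambda_max A <= a <-> psd_form (a%:M - A).
Proof.
move=> As; have [s es ps] := max_eigenvalue As.
have ub b : psd_form (b%:M - A) -> ubound [set x | eigenvalue A x] b.
  by move=> pb x /(eigenvalue_le pb).
split => [la v|pa].
  have sa : s <= a.
    by apply: le_trans la; apply: ub_le_sup => //; exists s; exact: ub.
  have := ps v; rewrite !qformB !qform_scalar => /le_trans; apply.
  by rewrite lerD2r ler_wpM2r // dotrv_ge0.
by apply: ge_sup; [exists s|exact: ub].
Qed.

(** For [Q = S S^T] the trace of [Q M] is that of [S^T M S]. A small multiple of
    the identity makes [Q] definite, so that such a factor exists. *)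
Lemma mxtrace_psd_ge0 m (Q M : 'M[R]_m) : Q^T = Q -> psd_form Q -> psd_form M ->
  0 <= \tr (Q *m M).
Proof.
move=> Qs Q0 M0.
have posdef eps : 0 < eps -> 0 <= \tr (Q *m M) + eps * \tr M.
  move=> eps0; pose Q' := Q + eps%:M.
  have ee : equivalence_rel (fun _ _ : 'I_m => true) by [].
  have [|//|v v0|T TQ _] := @cholesky _ _ _ Q' ee.
  - by rewrite linearD /= tr_scalar_mx Qs.
  - rewrite qformD qform_scalar ltr_wpDl //.
    by rewrite mulr_gt0 // dotrv_gt0.
  have TU : T \in unitmx by have := TQ; rewrite -mulmxA => /mulmx1_unit[].
  have Q'E : Q' = invmx T *m (invmx T)^T.
    have : invmx T *m (T *m Q' *m T^T) *m (invmx T)^T = Q'.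
      by rewrite !mulmxA mulVmx // mul1mx trmx_inv mulmxK ?unitmx_tr.
    by rewrite TQ mulmx1.
  have -> : \tr (Q *m M) + eps * \tr M = \tr (Q' *m M).
    by rewrite mulmxDl mul_scalar_mx linearD /= linearZ.
  rewrite Q'E -mulmxA mxtrace_mulC sumr_ge0 // => i _.
  set X := (invmx T)^T; rewrite -[invmx T]trmxK -/X -entryE -/(qform _ _).
  by rewrite qform_congr.
have trM : 0 <= \tr M.
  by apply: sumr_ge0 => i _; rewrite -entryE; exact: M0.
rewrite leNgt; apply/negP => neg.
have := posdef (- \tr (Q *m M) / (2 * (\tr M + 1))).
rewrite divr_gt0 ?oppr_gt0 ?mulr_gt0 //; [move=> /(_ isT)|lra].
rewrite mulrAC -mulrA => h.
have : \tr M / (2 * (\tr M + 1)) <= 1 / 2.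
  by rewrite ler_pdivrMr; lra.
nra.
Qed.

End Spectral.

(** * Support functions of spectratopes *)

Section SupportFunctions.
Context {R : realType}.
Implicit Types (m n : nat).

Definition same_block m k : rel 'I_m := fun i j => (i %/ k == j %/ k)%N.

Lemma same_block_equivalence m k : equivalence_rel (@same_block m k).
Proof. by move=> i j l; split => [|/eqP]; rewrite /same_block // => ->. Qed.

Lemma symblock_supported m k (A : 'M[R]_m) :
  symblock k A -> supported (@same_block m k) A.
Proof. by case. Qed.

(** The block diagonal part of [v^T v], the sum of the rank one matrices of the
    restrictions of [v] to the blocks. *)
Definition block_square m k (v : 'rV[R]_m) : 'M[R]_m :=
  \matrix_(a, b) if same_block k a b then v 0 a * v 0 b else 0.

Lemma block_square_psd m k (v : 'rV[R]_m) : psd (block_square k v).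
Proof.
split.
  apply/matrixP => a b; rewrite !mxE /same_block eq_sym.
  by case: ifP => // _; rewrite mulrC.
move=> u; rewrite -/(qform _ _) qformE.
pose x a := u 0 a * v 0 a.
pose f (a c : 'I_m) : R := (a %/ k == c)%N%:R.
have -> : \sum_a \sum_b u 0 a * block_square k v a b * u 0 b =
          \sum_(c < m) (\sum_a f a c * x a) ^+ 2.
  rewrite (eq_bigr (fun a => \sum_b \sum_(c < m) f a c * f b c * (x a * x b))).
    under eq_bigr do rewrite exchange_big.
    rewrite exchange_big; apply: eq_bigr => c _.
    rewrite expr2 mulr_suml; apply: eq_bigr => a _.
    by rewrite mulr_sumr; apply: eq_bigr => b _ /=; ring.
  move=> a _; apply: eq_bigr => b _; rewrite -mulr_suml mxE /same_block.
  have am : (a %/ k < m)%N by apply: leq_ltn_trans (leq_div _ _) _.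
  rewrite (bigD1 (Ordinal am)) //= big1 => [|c ca]; last first.
    by rewrite /f (_ : (a %/ k == c)%N = false) ?mul0r //;
       apply: contraNF ca => /eqP ac; apply/eqP/val_inj.
  rewrite /f /= eqxx eq_sym addr0 mul1r /x.
  by case: ifP => _; rewrite ?mulr1n ?mulr0n; ring.
by apply: sumr_ge0 => c _; rewrite sqr_ge0.
Qed.

Lemma mxtrace_block_square m k (H : 'M[R]_m) v :
  supported (@same_block m k) H -> \tr (H *m block_square k v) = qform H v.
Proof.
move=> sH; rewrite qformE; apply: eq_bigr => a _; rewrite mxE.
apply: eq_bigr => b _; rewrite mxE /same_block eq_sym -/(same_block k a b).
have [_|/sH->] := boolP (same_block k a b); first by ring.
by rewrite !(mul0r, mulr0).
Qed.

(** The support function of the spectraplex in direction [H] is the largest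
    eigenvalue of [H], whatever the blocks: rank one matrices in one block are
    enough to reach it. *)
Lemma sup_spectraplex_le m k (H : 'M[R]_m.+1) a : symblock k H ->
  sup [set \tr (H *m M) | M in spectraplex k] <= a <-> psd_form (a%:M - H).
Proof.
move=> [Hs sH]; have sym b : (b%:M - H)^T = b%:M - H.
  by rewrite linearB /= tr_scalar_mx Hs.
have trle b M : psd_form (b%:M - H) -> spectraplex k M -> \tr (H *m M) <= b.
  move=> pb [_ trM [_ pM]]; have := mxtrace_psd_ge0 (sym b) pb pM.
  by rewrite mulmxBl mul_scalar_mx linearB /= linearZ /= trM mulr1 subr_ge0.
pose M v : 'M[R]_m.+1 := (dotrv v v)^-1 *: block_square k v.
have spM v : v != 0 -> spectraplex k (M v).
  move=> v0; have d0 := dotrv_gt0 v0; have [bs bp] := block_square_psd k v.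
  split.
  - split; first by rewrite linearZ /= bs.
    by move=> i j /negbTE ij; rewrite !mxE /same_block ij mulr0.
  - rewrite linearZ /= -[block_square k v]mul1mx mxtrace_block_square.
      by rewrite qform1 mulVf // gt_eqF.
    move=> i j nij; rewrite mxE; case: eqP nij => // ->.
    by rewrite /same_block eqxx.
  - split=> [|u]; first by rewrite linearZ /= bs.
    by rewrite -/(qform _ _) qformZ mulr_ge0 ?invr_ge0 ?dotrv_ge0 //; exact: bp.
have trM v : \tr (H *m M v) = (dotrv v v)^-1 * qform H v.
  by rewrite -scalemxAr linearZ /= mxtrace_block_square.
have [eta etaH] : exists eta, forall i j, `|H i j| <= eta.
  exists (\sum_i \sum_j `|H i j|) => i j; rewrite (bigD1 i) //= (bigD1 j) //=.
  by rewrite -addrA lerDl addr_ge0 // sumr_ge0 // => *; rewrite sumr_ge0.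
have bnd : psd_form ((eta * m.+1%:R)%:M - H).
  move=> v; rewrite qformB qform_scalar subr_ge0.
  by apply: le_trans (ler_norm _) (qform_le _ etaH).
have e0 : (delta_mx 0 0 : 'rV[R]_m.+1) != 0.
  by rewrite -dotrv_eq0 dotrv_delta mxE !eqxx oner_eq0.
split => [le_a v|pa]; last first.
  apply: ge_sup => [|_ [N sN <-]]; last exact: trle.
  by exists (\tr (H *m M (delta_mx 0 0))), (M (delta_mx 0 0)) => //; exact: spM.
have [->|v0] := eqVneq v 0; first by rewrite /qform !mul0mx mxE.
rewrite qformB qform_scalar subr_ge0 -ler_pdivrMr ?dotrv_gt0 // mulrC -trM.
apply: le_trans le_a; apply: ub_le_sup; last by exists (M v) => //; exact: spM.
by exists (eta * m.+1%:R) => _ [N sN <-]; exact: trle.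
Qed.

(** The symmetric block diagonal matrix that represents a linear functional on
    symmetric block diagonal matrices for the trace pairing. *)
Definition representing m k (l : 'M[R]_m -> R) : 'M[R]_m :=
  \matrix_(a, b) if same_block k a b
                 then (l (delta_mx a b) + l (delta_mx b a)) / 2 else 0.

Lemma representing_symblock m k (l : 'M[R]_m -> R) :
  symblock k (representing k l).
Proof.
split => [|a b /negbTE ab]; last by rewrite mxE /same_block ab.
by apply/matrixP => a b; rewrite !mxE /same_block eq_sym addrC.
Qed.

Lemma representingP m k (l : {linear 'M[R]_m -> R^o}) (M : 'M[R]_m) :
  symblock k M -> l M = \tr (representing k l *m M).
Proof.
move=> [Ms sM].
have Msym a b : M b a = M a b by rewrite -[in RHS]Ms mxE.
have lM : l M = \sum_a \sum_b M a b * l (delta_mx a b).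
  rewrite [in LHS](matrix_sum_delta M) linear_sum; apply: eq_bigr => a _.
  by rewrite linear_sum; apply: eq_bigr => b _; rewrite linearZ.
have lM' : l M = \sum_a \sum_b M a b * l (delta_mx b a).
  rewrite lM exchange_big; apply: eq_bigr => a _; apply: eq_bigr => b _.
  by rewrite (Msym b a).
rewrite (_ : l M = (l M + l M) / 2); last by field.
rewrite [X in (X + _) / 2]lM [X in (_ + X) / 2]lM' -big_split /= mulr_suml.
apply: eq_bigr => a _; rewrite -big_split /= mulr_suml mxE.
apply: eq_bigr => b _; rewrite mxE (Msym a b).
have [_|/sM->] := boolP (same_block k a b); first by field.
by rewrite !(mul0r, mulr0, addr0).
Qed.

Lemma symblock_pencil n m k (A0 : 'M[R]_m) (A : 'I_n -> 'M[R]_m) y :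
  symblock k A0 -> (forall i, symblock k (A i)) -> symblock k (pencil A0 A y).
Proof.
move=> sA0 sA; split => [|i j ij]; last first.
  rewrite /pencil mxE summxE sA0.2 // addr0 big1 // => l _.
  by rewrite mxE (sA l).2 // mulr0.
rewrite /pencil linearD /= linear_sum sA0.1 /=.
by congr (_ + _); apply: eq_bigr => l _; rewrite linearZ /= (sA l).1.
Qed.

(** The affine chart of a hemisphere and the matching points: pairing
    [chart y] with [lifted kap z] gives the tangent at [z], evaluated at [y]. *)
Definition chart n (y : 'rV[R]_n) : 'rV[R]_n.+1 :=
  \row_i if unlift ord0 i is Some j then y 0 j else 1.

Definition lifted n (kap : R) (z : 'rV[R]_n) : 'rV[R]_n.+1 :=
  \row_i if unlift ord0 i is Some j then 2 * kap * z 0 j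
         else - (kap * dotrv z z).

Lemma dotrv_chart n (y : 'rV[R]_n) x :
  dotrv (chart y) x = x 0 ord0 + \sum_i y 0 i * x 0 (lift ord0 i).
Proof.
rewrite /dotrv big_ord_recl mxE unlift_none mul1r; congr (_ + _).
by apply: eq_bigr => i _; rewrite mxE liftK.
Qed.

Lemma dotrv_chart_lifted n kap (y z : 'rV[R]_n) :
  dotrv (chart y) (lifted kap z) = tangent kap z y.
Proof.
rewrite dotrv_chart mxE unlift_none /tangent mulrBr addrC; congr (_ - _).
rewrite /dotrv !mulr_sumr; apply: eq_bigr => i _.
by rewrite mxE liftK; ring.
Qed.

(** In an affine chart the support function of a spectratope is the largest
    eigenvalue of a pencil. *)
Lemma spectratope_pencil n m k (S : set 'rV[R]_n.+1) :
  spectratope m.+1 k S ->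
  exists A0 (A : 'I_n -> 'M[R]_m.+1),
    [/\ symblock k A0, forall i, symblock k (A i) &
    forall (y : 'rV[R]_n) rho a, 0 < rho ->
      rho * support_function S (rho^-1 *: chart y) <= a <->
      psd_form (a%:M - pencil A0 A y)].
Proof.
case=> g ->.
pose G i := representing k (fun M => g M 0 i).
exists (G ord0), (fun i => G (lift ord0 i)); split => [|i|y rho a rho0];
  do ?exact: representing_symblock.
have GE i M : symblock k M -> g M 0 i = \tr (G i *m M).
  pose l : 'M[R]_m.+1 -> R^o := fun M => g M 0 i.
  have ll : linear l by move=> c A B; rewrite /l linearP !mxE.
  pose L : {linear 'M[R]_m.+1 -> R^o} :=
    HB.pack l (GRing.isLinear.Build _ _ _ _ l ll).
  by move=> sM; rewrite /G -(representingP L sM).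
pose P := pencil (G ord0) (fun i => G (lift ord0 i)) y.
have sG i : symblock k (G i) by exact: representing_symblock.
have sP : symblock k P by exact: symblock_pencil.
rewrite -ler_pdivlMl // mulrC.
have -> : support_function (g @` spectraplex k) (rho^-1 *: chart y) =
  sup [set \tr ((rho^-1 *: P) *m M) | M in spectraplex k].
  congr sup; rewrite /support_function image_comp; apply: eq_imagel => M [sM _ _].
  rewrite /= dotrvZl -scalemxAl linearZ /= dotrv_chart (GE _ _ sM); congr (_ * _).
  rewrite mulmxDl linearD /= addrC mulmx_suml linear_sum /=; congr (_ + _).
  by apply: eq_bigr => i _; rewrite -scalemxAl linearZ /= (GE _ _ sM).
have sP' : symblock k (rho^-1 *: P).
  split => [|i j ij]; first by rewrite linearZ /= sP.1.
  by rewrite mxE sP.2 // mulr0.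
rewrite (sup_spectraplex_le _ sP').
have -> : (a / rho)%:M - rho^-1 *: P = rho^-1 *: (a%:M - P).
  by rewrite scalerBr scale_scalar_mx mulrC.
split => h v; have := h v; rewrite qformZ ?pmulr_rge0 ?invr_gt0 //.
Qed.

End SupportFunctions.

(** * Counting rounded pencils *)

Section Counting.
Context {R : realType}.
Implicit Types (m n : nat).

Lemma unmatched (S C : finType) (rel : S -> C -> Prop) :
  (#|C| < #|S|)%N -> (forall s s' c, rel s c -> rel s' c -> s = s') ->
  exists s, forall c, ~ rel s c.
Proof.
move=> card inj; apply: contrapT => /forallNP all_matched.
have matched s : exists c, rel s c.
  by apply: contrapT => /forallNP; exact: all_matched.
have [f fP] := boolp.choice matched.
have : injective f by move=> s s' ff; apply: (inj _ _ (f s)); rewrite // ff.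
by move=> /leq_card; rewrite leqNgt card.
Qed.

(** The index, among [B] subintervals of [-T, T], of the one that contains [x]. *)
Definition digit (B : nat) (T x : R) : 'I_B.+1 :=
  inord (Num.truncn ((x + T) / (2 * T) * B%:R)).

Lemma digit_close B T x y : 0 < T -> (0 < B)%N -> `|x| <= T -> `|y| <= T ->
  digit B T x = digit B T y -> `|x - y| <= 2 * T / B%:R.
Proof.
move=> T0 B0; rewrite !ler_norml => /andP[xl xu] /andP[yl yu].
pose p z := (z + T) / (2 * T) * B%:R.
have pb z : - T <= z -> z <= T -> 0 <= p z <= B%:R.
  move=> zl zu; rewrite /p mulr_ge0 ?divr_ge0 //=; do ?lra.
  by rewrite ler_piMl // ler_pdivrMr; lra.
have tr z : - T <= z -> z <= T -> (Num.truncn (p z) < B.+1)%N.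
  move=> zl zu; have /andP[p0 p1] := pb z zl zu.
  by rewrite truncn_lt_nat // (le_lt_trans p1) // ltr_nat.
move=> /(congr1 val); rewrite /= !inordK ?tr // -/(p x) -/(p y) => pxy.
have /truncn_itv/andP[x1 x2] : 0 <= p x by case/andP: (pb x xl xu).
have /truncn_itv/andP[y1 y2] : 0 <= p y by case/andP: (pb y yl yu).
rewrite pxy in x1 x2; rewrite -natr1 in x2; rewrite -natr1 in y2.
have B0' : 0 < B%:R :> R by rewrite ltr0n.
have -> : x - y = 2 * T / B%:R * (p x - p y).
  by rewrite /p; field; rewrite !gt_eqF.
have c0 : 0 <= 2 * T / B%:R by rewrite divr_ge0 ?mulr_ge0 ?ltW.
have p1 : p x - p y <= 1 by lra.
have p2 : - 1 <= p x - p y by lra.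
by apply/andP; split; nra.
Qed.

(** A finite record of a family of block diagonal matrices, up to rounding: row
    [a] lists the [k] entries of its block only, which is where the exponent
    [1 + t] comes from. The record has the same size for all [m <= rows] and
    [k <= cols]; positions outside the matrix hold the digit of [0]. *)
Definition code (I : finType) m (k rows cols B : nat) (T : R)
    (X : I -> 'M[R]_m) : {ffun I * 'I_rows * 'I_cols -> 'I_B.+1} :=
  [ffun p : I * 'I_rows * 'I_cols => digit B T
     (match insub (val p.1.2), insub (p.1.2 %/ k * k + p.2)%N with
      | Some a, Some b => X p.1.1 a b
      | _, _ => 0
      end)].

Lemma code_close (I : finType) m k rows cols B T (X Y : I -> 'M[R]_m) :
  0 < T -> (0 < B)%N -> (m <= rows)%N -> (0 < k <= cols)%N ->
  (forall l, supported (@same_block m k) (X l)) ->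
  (forall l, supported (@same_block m k) (Y l)) ->
  (forall l a b, `|X l a b| <= T) -> (forall l a b, `|Y l a b| <= T) ->
  code k rows cols B T X = code k rows cols B T Y ->
  forall l a b, `|X l a b - Y l a b| <= 2 * T / B%:R.
Proof.
move=> T0 B0 mr /andP[k0 kc] sX sY bX bY XY l a b.
have [ab|nab] := boolP (same_block k a b); last first.
  rewrite sX // sY // subr0 normr0.
  by rewrite divr_ge0 // mulr_ge0 // ltW.
have ar : (a < rows)%N by apply: leq_trans mr.
have bc : (b %% k < cols)%N by apply: leq_trans kc; rewrite ltn_mod.
have /ffunP/(_ (l, Ordinal ar, Ordinal bc)) := XY; rewrite !ffunE /=.
have bE : (a %/ k * k + b %% k)%N = b by rewrite (eqP ab) -divn_eq.
by rewrite bE !valK; apply: digit_close.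
Qed.

(** What [dichotomy] provides about the normalized pencil of a function that is
    close to the envelope of [P]. *)
Definition tells_apart n m (W : 'M[R]_m) (C : 'I_n -> 'M[R]_m)
    (P : set 'rV[R]_n) (kap r s M th : R) :=
  forall y, cube r y ->
    let test := normal W C ((1 - th) *: y)
      (2 * M - (kap * dotrv y y - kap * s ^+ 2 / 2)) in
    (P y -> exists v, test v < 0) /\
    ((forall p, P p -> s ^+ 2 <= dotrv (y - p) (y - p)) ->
      forall v, th / 2 * dotrv v v <= test v).

Lemma normal_close n m (W W' : 'M[R]_m) (C C' : 'I_n -> 'M[R]_m) y b r D eta v :
  cube r y -> `|b| <= D ->
  (forall i j, `|W i j - W' i j| <= eta) ->
  (forall l i j, `|C l i j - C' l i j| <= eta) ->
  `|normal W C y b v - normal W' C' y b v| <=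
    (n%:R * r + D) * (eta * m%:R * dotrv v v).
Proof.
move=> yr bD dW dC; set e := eta * _ * _.
have eW : `|qform W v - qform W' v| <= e.
  by rewrite -qformB; apply: qform_le => i j; rewrite !mxE.
have eC l : `|qform (C l) v - qform (C' l) v| <= e.
  by rewrite -qformB; apply: qform_le => i j; rewrite !mxE.
rewrite /normal; set S := \sum_i _; set S' := \sum_i _.
have -> : dotrv v v - S - b * qform W v - (dotrv v v - S' - b * qform W' v) =
          - ((S - S') + b * (qform W v - qform W' v)) by ring.
rewrite normrN mulrDl (le_trans (ler_normD _ _)) // lerD //; last first.
  by rewrite normrM ler_pM.
rewrite -sumrB (le_trans (ler_norm_sum _ _ _)) //.
apply: (@le_trans _ _ (\sum_(i < n) r * e)).
  by apply: ler_sum => i _; rewrite -mulrBr normrM ler_pM.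
by rewrite sumr_const card_ord -(mulr_natl (r * e)) mulrA lexx.
Qed.

Definition selects n (J : finType) (y : J -> 'rV[R]_n) (s : R)
    (Sel : {set J}) (P : set 'rV[R]_n) :=
  forall j, (j \in Sel -> P (y j)) /\
    (j \notin Sel -> forall p, P p -> s ^+ 2 <= dotrv (y j - p) (y j - p)).

(** If there are fewer codes than selections then some selection is not produced
    by any pencil: two pencils with the same code make the same tests, hence
    belong to the same selection. *)
Lemma missed_selection n (J : finType) (y : J -> 'rV[R]_n.+1) (k : nat -> nat)
    (rows cols B : nat) (kap r s : R)
    (M := 4 * kap * n.+1%:R * r ^+ 2) (del := kap * s ^+ 2 / 8)
    (T := M^-1 + r^-1) :
  0 < kap -> 0 < s <= r -> (0 < B)%N -> (forall j, cube r (y j)) ->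
  (n.+1%:R * r + 3 * M) * (2 * T / B%:R * rows%:R) <= del / M / 2 ->
  (rows * B.+1 ^ (n.+2 * rows * cols) < 2 ^ #|J|)%N ->
  exists Sel : {set J}, forall P : set 'rV[R]_n.+1,
    P !=set0 -> selects y s Sel P ->
    forall m, (m < rows)%N -> (0 < k m <= cols)%N ->
    forall (A0 : 'M[R]_m) (A : 'I_n.+1 -> 'M[R]_m),
      symblock (k m) A0 -> (forall i, symblock (k m) (A i)) ->
      ~ approximates A0 A (envelope kap P) r del.
Proof.
move=> kap0 sr B0 yr prec count; have /andP[s0 s_r] := sr.
have r0 : 0 < r by exact: lt_le_trans s_r.
have M0 : 0 < M by rewrite !mulr_gt0 ?exprn_gt0.
have T0 : 0 < T by rewrite addr_gt0 ?invr_gt0.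
have nr : r ^+ 2 <= n.+1%:R * r ^+ 2 by rewrite ler_peMl ?sqr_ge0 // ler1n.
have s2r2 : s ^+ 2 <= r ^+ 2 by rewrite ler_sqr ?nnegrE ?(ltW s0) ?(ltW r0).
have ks2 : 0 <= kap * s ^+ 2 <= M / 4.
  rewrite mulr_ge0 ?sqr_ge0 ?(ltW kap0) //=.
  have -> : M / 4 = kap * (n.+1%:R * r ^+ 2) by rewrite /M; field.
  by rewrite ler_wpM2l ?(ltW kap0) // (le_trans s2r2).
pose th := del / M.
have th0 : 0 < th by rewrite !divr_gt0 ?mulr_gt0 ?exprn_gt0.
have th1 : th <= 1 by rewrite ler_pdivrMr // /del; lra.
pose fam m W C : option 'I_n.+1 -> 'M[R]_m :=
  fun l => if l is Some i then C i else W.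
pose rel (Sel : {set J}) (c : 'I_rows * {ffun _ -> 'I_B.+1}) :=
  exists (P : set 'rV[R]_n.+1) (W : 'M[R]_c.1) (C : 'I_n.+1 -> 'M[R]_c.1),
  [/\ selects y s Sel P,
      (0 < k c.1 <= cols)%N,
      forall l, supported (@same_block _ (k c.1)) (fam _ W C l),
      forall l a b, `|fam _ W C l a b| <= T &
      tells_apart W C P kap r s M th /\
      c.2 = code (k c.1) rows cols B T (fam _ W C)].
have [||Sel SelP] := @unmatched _ _ rel.
- rewrite card_prod !card_ord card_ffun !card_prod !card_ord card_option card_ord.
  by rewrite -(cardsT {set J}) -powersetT card_powerset cardsT.
- suff sub Sel Sel' c j : rel Sel c -> rel Sel' c -> j \in Sel -> j \in Sel'.
    move=> S S' c SC SC'; apply/setP => j.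
    by apply/idP/idP; [exact: sub SC SC'|exact: sub SC' SC].
  case: c => m c [P [W [C [/= selP kc sWC bWC [apart cE]]]]].
  case=> [P' [W' [C' [/= selP' _ sWC' bWC' [apart' cE']]]]] jSel.
  apply: contrapT => /negP jSel'.
  have [_ /(_ ((selP' j).2 jSel'))] := apart' _ (yr j).
  have [/(_ ((selP j).1 jSel)) [v vneg] _] := apart _ (yr j) => /(_ v).
  have close := code_close T0 B0 (ltnW (ltn_ord m)) kc sWC sWC' bWC bWC'
    (etrans (esym cE) cE').
  set z := (1 - th) *: y j in vneg *.
  set b := 2 * M - _ in vneg *.
  have zr : cube r z.
    move=> i; rewrite !mxE normrM (le_trans _ (yr j i)) // ler_piMl //.
    by rewrite ger0_norm; lra.
  have bM : `|b| <= 3 * M.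
    have := dotrv_cube (yr j); have := dotrv_ge0 (y j) => d0 dr.
    have : 0 <= kap * dotrv (y j) (y j) <= M / 4.
      rewrite mulr_ge0 ?(ltW kap0) //=.
      have -> : M / 4 = kap * (n.+1%:R * r ^+ 2) by rewrite /M; field.
      by rewrite ler_wpM2l ?(ltW kap0).
    by rewrite ler_norml /b => /andP[? ?]; apply/andP; split; lra.
  have := normal_close v zr bM (close None) (fun i => close (Some i)).
  rewrite ler_norml => /andP[dl du] test'; move: du dl test' vneg.
  set X := normal W _ _ _ _; set X' := normal W' _ _ _ _.
  have : (n.+1%:R * r + 3 * M) * (2 * T / B%:R * m%:R * dotrv v v) <=
         th / 2 * dotrv v v.
    rewrite mulrA ler_wpM2r ?dotrv_ge0 // (le_trans _ prec) //.
    rewrite ler_wpM2l //.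
      by rewrite addr_ge0 // mulr_ge0 // ltW.
    rewrite ler_wpM2l ?ler_nat ?(ltnW (ltn_ord m)) //.
    by rewrite divr_ge0 // mulr_ge0 // ltW.
  by rewrite /=; lra.
exists Sel => P P0 selP m mr kc A0 A sA0 sA appr.
have [W [C [[sW sC] bW bC apart]]] :=
  dichotomy (@same_block_equivalence m (k m)) kap0 sr P0 sA0.1
    (fun i => (sA i).1) (symblock_supported sA0)
    (fun i => symblock_supported (sA i)) appr.
apply: (SelP (Ordinal mr, code (k m) rows cols B T (fam m W C))).
exists P, W, C; split => //; first by case=> [i|] /=.
move=> [i|] a b /=.
  by rewrite (le_trans (bC _ _ _)) // lerDr invr_ge0 ltW.
by rewrite (le_trans (bW _ _)) // lerDl invr_ge0 ltW.
Qed.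

End Counting.

(** * Asymptotics of the parameters of a level *)

Section Levels.
Context {R : realType}.
Implicit Types (n i g : nat).

Lemma nat_eventually_ge (D : R) :
  exists i0, forall i, (i0 <= i)%N -> D <= i.+1%:R.
Proof.
exists (Num.truncn D) => i Di; rewrite ltW // (lt_le_trans (truncnS_gt D)) //.
by rewrite ler_nat ltnS.
Qed.

Lemma bernoulli_ineq (a : R) i : 0 <= a -> 1 + i%:R * a <= (1 + a) ^+ i.
Proof.
move=> a0; elim: i => [|i IH]; first by rewrite mul0r addr0 expr0.
rewrite exprS -natr1; have i0 : 0 <= i%:R :> R by [].
apply: le_trans (_ : (1 + a) * (1 + i%:R * a) <= _); first nra.
by rewrite ler_wpM2l // addr_ge0.
Qed.

(** By Bernoulli, [p^i] grows at least linearly, so its ninth power beats the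
    eighth power of [i]. *)
Lemma geometric_beats_polynomial (p D : R) : 1 < p ->
  exists i0, forall i, (i0 <= i)%N -> D * i.+1%:R ^+ 8 <= (p ^+ 9) ^+ i.
Proof.
move=> p1; pose h := Num.min 1 (p - 1).
have h0 : 0 < h by rewrite lt_min ltr01 subr_gt0.
have hp i : h * i.+1%:R <= p ^+ i.
  have p10 : 0 <= p - 1 by rewrite subr_ge0 ltW.
  have := bernoulli_ineq i p10; rewrite subrKC; apply: le_trans.
  rewrite -natr1 mulrDr mulr1 addrC lerD ?ge_min ?lexx // mulrC.
  by rewrite ler_wpM2l // ge_min lexx orbT.
have [i0 Hi0] := nat_eventually_ge (D / h ^+ 9).
exists i0 => i /Hi0; rewrite ler_pdivrMr ?exprn_gt0 // => Dh.
rewrite -exprM mulnC exprM.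
apply: (@le_trans _ _ ((h * i.+1%:R) ^+ 9)).
  have -> : (h * i.+1%:R) ^+ 9 = i.+1%:R * h ^+ 9 * i.+1%:R ^+ 8 by ring.
  by rewrite ler_wpM2r // exprn_ge0.
rewrite lerXn2r ?nnegrE ?exprn_ge0 ?mulr_ge0 ?(ltW h0) //.
by rewrite ltW // (lt_trans _ p1).
Qed.

Section Numerics.
Variables (N : nat) (x u c : R).
Hypotheses (N0 : (0 < N)%N) (x1 : 1 <= x <= 4) (u1 : 1 <= u <= 2).
Hypotheses (xu : x ^+ N = 2 * u) (c0 : 0 < c).

(** Here [x ^+ i] stands for [2^(i (1+t) / N)] and [u ^+ i] for [2^(i t)].
    Level [i] treats the sizes between [2^i] and [2^(i+1)]. Its grid has [grid i]
    points in each of the [N] directions; the factor [(i+1)^2] absorbs the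
    logarithms of the counting bound. *)
Definition grid i : nat := (Num.truncn (i.+1%:R ^+ 2 * x ^+ i)).+1.
Definition blocksize i : nat := Num.truncn (c * u ^+ i.+1).
(** The exponent 14: the gap to resolve is of the order of the squared spacing,
    at least [2^(-12 i)], the number of rows costs one more factor [2^(i+1)], and
    a last one absorbs the constants. *)
Definition precision i : nat := (2 ^ (14 * i.+1))%N.

Lemma x_gt0 : 0 < x.
Proof. by case/andP: x1 => xl _; exact: lt_le_trans xl. Qed.

Lemma xi1 i : 1 <= x ^+ i.
Proof. by rewrite exprn_ege1 //; case/andP: x1. Qed.

Lemma xi4 i : x ^+ i <= 4 ^+ i.
Proof.
have /andP[xl xr] := x1.
by rewrite lerXn2r ?nnegrE // (le_trans _ xl).
Qed.

Lemma grid_ge i : i.+1%:R ^+ 2 * x ^+ i < (grid i)%:R.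
Proof. exact: truncnS_gt. Qed.

Lemma gridS_le i : (grid i).+1%:R <= 3 * (i.+1%:R ^+ 2 * x ^+ i).
Proof.
have h : 1 <= i.+1%:R ^+ 2 * x ^+ i.
  by rewrite mulr_ege1 ?xi1 // exprn_ege1 // ler1n.
have : (Num.truncn (i.+1%:R ^+ 2 * x ^+ i))%:R <= i.+1%:R ^+ 2 * x ^+ i.
  by rewrite truncn_le (le_trans _ h).
rewrite /grid -[_.+2%:R]natr1 -natr1; lra.
Qed.

(** Level [i] takes about [(i+1) (2 u)^i] bits for a code, and a selection offers
    [grid i ^ N >= (i+1)^2 (2 u)^i] bits. *)
Lemma code_count : exists i0, forall i, (i0 <= i)%N ->
  (2 ^ i.+1 * (precision i).+1 ^ (N.+1 * 2 ^ i.+1 * blocksize i)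
    < 2 ^ (grid i ^ N))%N.
Proof.
have [i0 Hi0] := nat_eventually_ge (1 + 60 * N.+1%:R * c).
exists i0 => i /Hi0 ci.
set e := (N.+1 * 2 ^ i.+1 * blocksize i)%N.
apply: (@leq_ltn_trans (2 ^ (i.+1 + 15 * i.+1 * e))).
  rewrite expnD leq_mul2l expnM; apply/orP; right.
  have [->|e0] := posnP e; first by rewrite !expn0.
  rewrite leq_exp2r // (mulnDl 14 1) mul1n expnD -/(precision i).
  have : (0 < precision i)%N by rewrite expn_gt0.
  have : (2 <= 2 ^ i.+1)%N by rewrite expnS leq_pmulr // expn_gt0.
  move=> h2 h0; apply: leq_trans (leq_mul (leqnn _) h2).
  by rewrite muln2 -addnn -addn1 leq_add2l.
rewrite ltn_exp2l // -(ltr_nat R) natrD !natrM !natrX.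
pose Z : R := (2 * u) ^+ i.
have u0 : 0 < u by case/andP: u1 => ? _; rewrite (lt_le_trans ltr01).
have Z1 : 1 <= Z by rewrite exprn_ege1 //; case/andP: u1; lra.
have gZ : i.+1%:R ^+ 2 * Z < (grid i)%:R ^+ N.
  apply: (@le_lt_trans _ _ ((i.+1%:R ^+ 2 * x ^+ i) ^+ N)); last first.
    by rewrite ltrXn2r -?lt0n // ?nnegrE ?mulr_ge0 ?exprn_ge0 ?grid_ge //;
       case/andP: x1; lra.
  rewrite exprMn -(exprM x) (mulnC i) (exprM x) xu -/Z.
  rewrite ler_wpM2r ?(le_trans _ Z1) //.
  by rewrite -exprM ler_weXn2l ?ler1n // leq_pmulr.
apply: le_lt_trans gZ.
have Kb : (blocksize i)%:R <= 2 * c * u ^+ i.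
  apply: (@le_trans _ _ (c * u ^+ i.+1)).
    by rewrite truncn_le mulr_ge0 ?(ltW c0) ?exprn_ge0 ?(ltW u0).
  rewrite exprS mulrCA mulrA ler_wpM2r ?exprn_ge0 ?(ltW u0) //.
  by rewrite ler_wpM2r ?(ltW c0) //; case/andP: u1.
have Zb : 2 ^+ i.+1 * (blocksize i)%:R <= 4 * c * Z.
  rewrite /Z exprMn exprS.
  have -> : 4 * c * (2 ^+ i * u ^+ i) = 2 * 2 ^+ i * (2 * c * u ^+ i) by ring.
  by rewrite ler_wpM2l // mulr_ge0 // exprn_ge0.
have i1 : 0 <= i.+1%:R :> R by [].
have N1 : 0 <= N.+1%:R :> R by [].
apply: (@le_trans _ _ (i.+1%:R * (1 + 60 * N.+1%:R * c) * Z)); last first.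
  by rewrite ler_wpM2r ?(le_trans _ Z1) // expr2 ler_wpM2l.
have h1 : i.+1%:R <= i.+1%:R * Z by rewrite ler_peMr.
have := ler_wpM2l (mulr_ge0 (mulr_ge0 (ler0n R 15) i1) N1) Zb.
rewrite -!mulrA in h1 *; lra.
Qed.

Lemma step_le (r : R) i : 0 < r ->
  r / (6 * i.+1%:R ^+ 4 * x ^+ i) <= r / (i.+1%:R * i.+2%:R * (grid i).+1%:R).
Proof.
move=> r0; have x0 : 0 < x ^+ i by rewrite (lt_le_trans _ (xi1 i)).
rewrite ler_wpM2l ?(ltW r0) // lef_pV2 ?posrE ?mulr_gt0 ?exprn_gt0 ?x_gt0 //.
have gi := gridS_le i.
apply: (@le_trans _ _ (i.+1%:R * (2 * i.+1%:R) * (3 * (i.+1%:R ^+ 2 * x ^+ i)))).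
  rewrite ler_pM ?mulr_ge0 // ler_wpM2l //.
  by rewrite -natrM ler_nat mul2n -addnn addnS ltnS leq_addr.
by rewrite le_eqVlt; apply/orP; left; apply/eqP; ring.
Qed.

Lemma precision_enough (r D : R) : 0 < r -> 0 <= D ->
  exists i0, forall i, (i0 <= i)%N ->
  D * (2 ^ i.+1)%:R / (precision i)%:R <=
    (r / (i.+1%:R * i.+2%:R * (grid i).+1%:R)) ^+ 2.
Proof.
move=> r0 D0; have [i0 Hi0] := nat_eventually_ge (36 * D / r ^+ 2).
exists i0 => i /Hi0; rewrite ler_pdivrMr ?exprn_gt0 // => Di.
have x0 : 0 < x ^+ i by rewrite (lt_le_trans _ (xi1 i)).
have A0 : 0 < 6 * i.+1%:R ^+ 4 * x ^+ i by rewrite !mulr_gt0 ?exprn_gt0 ?x_gt0.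
apply: (@le_trans _ _ ((r / (6 * i.+1%:R ^+ 4 * x ^+ i)) ^+ 2)); last first.
  rewrite lerXn2r ?step_le ?nnegrE // divr_ge0 ?(ltW r0) ?(ltW A0) //.
have i2 : i.+1%:R <= 2 ^+ i :> R by rewrite -natrX ler_nat ltn_expl.
have -> : (precision i)%:R = (2 ^ i.+1)%:R * (2 ^+ 13) ^+ i.+1 :> R.
  by rewrite /precision (mulnDl 13%N 1%N) mul1n addnC expnD natrM -exprM !natrX.
rewrite [_ * (2 ^+ 13) ^+ _]mulrC -mulf_div divff ?mulr1 ?pnatr_eq0 ?expn_eq0 //.
rewrite [leRHS]exprMn exprVn ler_pdivrMr ?exprn_gt0 //.
rewrite mulrAC ler_pdivlMr ?exprn_gt0 //.
have x2 : x ^+ i * x ^+ i <= (2 ^+ 4) ^+ i.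
  have -> : (2 ^+ 4) ^+ i = 4 ^+ i * 4 ^+ i :> R.
    by rewrite -exprMn; congr (_ ^+ _); ring.
  by rewrite ler_pM ?xi4 // ltW.
have i8 : i.+1%:R ^+ 8 <= (2 ^+ 8) ^+ i :> R.
  by rewrite -exprM mulnC exprM lerXn2r ?nnegrE ?exprn_ge0.
apply: (@le_trans _ _ (36 * D * (i.+1%:R ^+ 8 * (x ^+ i * x ^+ i)))).
  by rewrite le_eqVlt; apply/orP; left; apply/eqP; ring.
apply: (@le_trans _ _ (i.+1%:R * r ^+ 2 * ((2 ^+ 8) ^+ i * (2 ^+ 4) ^+ i))).
  rewrite ler_pM ?mulr_ge0 ?exprn_ge0 ?(ltW x_gt0) //.
  by rewrite ler_pM ?mulr_ge0 ?exprn_ge0 ?(ltW x_gt0) //.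
rewrite (mulrC i.+1%:R) -mulrA ler_wpM2l ?sqr_ge0 // -exprMn -exprD.
apply: (@le_trans _ _ (2 ^+ i * (2 ^+ 12) ^+ i)).
  by rewrite ler_wpM2r ?exprn_ge0.
by rewrite -exprMn -exprS ler_weXn2l // exprn_ege1 // ler1n.
Qed.

End Numerics.
End Levels.

(** * A set that is hard at every level *)

Section Construction.
Context {R : realType}.
Implicit Types (m n i g : nat).

(** The telescoping sum of the widths [r / ((i+1) (i+2))] of the levels. *)
Definition offset (r : R) i : R := r * (1 - i.+1%:R^-1).

Definition spacing (r : R) g i : R := r / (i.+1%:R * i.+2%:R * g.+1%:R).

(** Level [i] lives in the cube with all coordinates between [offset r i] and
    [offset r i.+1]. Its grid starts and ends one step inside, so that it is at
    least one step away from the points of the other levels. *)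
Definition grid_point n (r : R) g i (j : {ffun 'I_n -> 'I_g}) : 'rV[R]_n :=
  \row_l (offset r i + spacing r g i * (j l).+1%:R).

Lemma offsetS r g i :
  offset r i.+1 = offset r i + spacing r g i * g.+1%:R.
Proof.
rewrite /offset /spacing; field.
by rewrite !nat1r -natrD !pnatr_eq0.
Qed.

Lemma spacing_gt0 r g i : 0 < r -> 0 < spacing r g i.
Proof. by move=> r0; rewrite divr_gt0 // !mulr_gt0. Qed.

Lemma spacing_le r g i : 0 < r -> spacing r g i <= r.
Proof.
move=> r0; rewrite ler_pdivrMr ?mulr_gt0 // ler_peMr ?(ltW r0) //.
by rewrite -!natrM ler1n !muln_gt0.
Qed.

Lemma offset_le r i i' : 0 < r -> (i <= i')%N -> offset r i <= offset r i'.
Proof.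
move=> r0 ii'; rewrite ler_wpM2l ?(ltW r0) // lerD2l lerN2.
by rewrite lef_pV2 ?posrE // ler_nat ltnS.
Qed.

Lemma grid_point_itv n r g i (j : {ffun 'I_n -> 'I_g}) l : 0 < r ->
  offset r i + spacing r g i <= grid_point r i j 0 l <=
  offset r i.+1 - spacing r g i.
Proof.
move=> r0; have s0 := spacing_gt0 g i r0.
rewrite mxE (offsetS _ g); have jg : (j l).+1%:R <= g%:R :> R by rewrite ler_nat.
have j1 : 1 <= (j l).+1%:R :> R by rewrite ler1n.
rewrite -(natr1 g) in jg *; apply/andP; split; nra.
Qed.

Lemma grid_point_cube n r g i (j : {ffun 'I_n -> 'I_g}) : 0 < r ->
  cube r (grid_point r i j).
Proof.
move=> r0 l; have /andP[lo up] := grid_point_itv i j l r0.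
have s0 := spacing_gt0 g i r0.
have off0 : 0 <= offset r i.
  by have := offset_le r0 (leq0n i); rewrite {1}/offset invr1 subrr mulr0.
have offr : offset r i.+1 <= r by rewrite ler_piMr ?(ltW r0) // gerBl invr_ge0.
by rewrite ler_norml; apply/andP; split; lra.
Qed.

Lemma grid_point_far n r g i (j : {ffun 'I_n.+1 -> 'I_g}) (p : 'rV[R]_n.+1) :
  0 < r ->
  [\/ p = 0,
      exists g' i' (j' : {ffun 'I_n.+1 -> 'I_g'}),
        i' != i /\ p = grid_point r i' j'
    | exists2 j' : {ffun 'I_n.+1 -> 'I_g}, j' != j & p = grid_point r i j'] ->
  spacing r g i ^+ 2 <= dotrv (grid_point r i j - p) (grid_point r i j - p).
Proof.
move=> r0 cases; set y := grid_point r i j; have s0 := spacing_gt0 g i r0.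
suff [l sl] : exists l, spacing r g i <= `|(y - p) 0 l|.
  apply: le_trans (sqr_coord_le _ l).
  by rewrite -[leRHS]real_normK ?num_real // lerXn2r ?nnegrE ?(ltW s0).
have /andP[lo up] := grid_point_itv i j ord0 r0; rewrite -/y in lo up.
have off0 : 0 <= offset r i.
  by have := offset_le r0 (leq0n i); rewrite {1}/offset invr1 subrr mulr0.
case: cases => [->|[g' [i' [j' [ii' ->]]]]|[j' jj' ->]].
- by exists ord0; rewrite subr0 (le_trans _ (ler_norm _)) //; lra.
- exists ord0; set z := grid_point r i' j'.
  have -> : (y - z) 0 ord0 = y 0 ord0 - z 0 ord0 by rewrite !mxE.
  have s0' := spacing_gt0 g' i' r0.
  have /andP[lo' up'] := grid_point_itv i' j' ord0 r0; rewrite -/z in lo' up'.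
  move: ii'; rewrite neq_ltn ler_normr.
  by case/orP=> /(offset_le r0) off; apply/orP; [left|right]; lra.
- have [l jl] : exists l, j' l != j l.
    apply: contrapT => /forallNP h; case/eqP: jj'; apply/ffunP => l.
    by apply/eqP/negPn/negP; exact: h.
  exists l; rewrite !mxE opprD addrACA subrr add0r -mulrBr normrM.
  rewrite gtr0_norm // ler_peMr ?(ltW s0) // ler_normr.
  rewrite !lerBrDr; move: jl; rewrite -val_eqE neq_ltn => /orP[] jl; apply/orP.
    by left; rewrite nat1r ler_nat.
  by right; rewrite opprB lerBrDr nat1r ler_nat.
Qed.

Lemma approximates_le n m (A0 : 'M[R]_m) (A : 'I_n -> 'M[R]_m) F r del del' :
  del <= del' -> approximates A0 A F r del -> approximates A0 A F r del'.
Proof.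
move=> dd appr y /appr[h1 h2]; split=> [v|a /h2 aF]; last first.
  by apply: le_trans aF; rewrite lerD2l lerN2.
have := h1 v; rewrite !qformB !qform_scalar => /le_trans; apply.
by rewrite lerD2r ler_wpM2r ?dotrv_ge0 // lerD2l.
Qed.

Lemma expn2_powR (e : R) i : (2 ^ i)%:R `^ e = (2 `^ e) ^+ i.
Proof.
rewrite -powR_mulrn ?powR_ge0 // -powRrM mulrC powRrM powR_mulrn //.
by rewrite natrX.
Qed.

(** One set [P] is hard for all large [m] at once: the level [trunc_log 2 m]
    selects a subset of its grid that the sizes with this logarithm miss. *)
Theorem hard_envelope n (r kap c t : R) (k : nat -> nat) :
  0 < r -> 0 < kap -> block_growth k c t ->
  exists P : set 'rV[R]_n.+1,
  [/\ P !=set0, forall z, P z -> cube r z &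
  forall C eps : R, 0 < C -> 0 < eps ->
  \forall m \near \oo, forall (A0 : 'M[R]_m) (A : 'I_n.+1 -> 'M[R]_m) del,
    symblock (k m) A0 -> (forall l, symblock (k m) (A l)) ->
    approximates A0 A (envelope kap P) r del ->
    C * m%:R `^ (- (2 * (1 + t) / n.+1%:R) - eps) <= del].
Proof.
move=> r0 kap0 [kdvd c0 /andP[t0 t1] [m1 _ km]].
(* [x ^+ i] is the inverse of the spacing that the parameter count allows for
   matrices of size [2^i] with blocks of size [u ^+ i]. *)
pose N := n.+1; pose x : R := 2 `^ ((1 + t) / N%:R); pose u : R := 2 `^ t.
have N0 : (0 < N)%N by [].
have u1 : 1 <= u <= 2.
  by rewrite -[X in X <= u](powRr0 2) -[X in u <= X]powRr1 ?ler_powR ?ler1n.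
have x1 : 1 <= x <= 4.
  rewrite -[X in X <= x](powRr0 2) ler_powR ?ler1n ?divr_ge0 ?addr_ge0 //=.
  have -> : 4 = 2 `^ 2%:R :> R by rewrite powR_mulrn //; ring.
  rewrite ler_powR ?ler1n // ler_pdivrMr //.
  have : 1 <= N%:R :> R by rewrite ler1n.
  by lra.
have xu : x ^+ N = 2 * u.
  rewrite -powR_mulrn ?powR_ge0 // -powRrM divfK ?pnatr_eq0 //.
  by rewrite powRD ?pnatr_eq0 ?implybT // powRr1.
pose g := grid x; pose s i := spacing r (g i) i.
pose M := 4 * kap * N%:R * r ^+ 2; pose T := M^-1 + r^-1.
have M0 : 0 < M by rewrite !mulr_gt0 ?exprn_gt0.
(* The constants in the precision that [missed_selection] asks for. *)
pose D := (N%:R * r + 3 * M) * (2 * T) * (16 * M / kap).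
have T0 : 0 < T by rewrite addr_gt0 ?invr_gt0.
have D0 : 0 <= D.
  apply: mulr_ge0; last by rewrite divr_ge0 ?mulr_ge0 ?ltW.
  by rewrite mulr_ge0 ?addr_ge0 ?(mulr_ge0 _ (ltW r0)) ?(mulr_ge0 _ (ltW M0))
             ?(mulr_ge0 _ (ltW T0)).
have [i1 count] := code_count N0 x1 u1 xu c0.
have [i2 prec] := precision_enough x1 r0 D0.
pose i0 := maxn i1 i2.
pose rows i := (2 ^ i.+1)%N; pose cols := blocksize u c.
have sel i : exists Sel : {set {ffun 'I_N -> 'I_(g i)}}, (i0 <= i)%N ->
    forall P : set 'rV[R]_N,
    P !=set0 -> selects (grid_point r i (g := g i)) (s i) Sel P ->
    forall m, (m < rows i)%N -> (0 < k m <= cols i)%N ->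
    forall (A0 : 'M[R]_m) (A : 'I_N -> 'M[R]_m),
      symblock (k m) A0 -> (forall l, symblock (k m) (A l)) ->
      ~ approximates A0 A (envelope kap P) r (kap * s i ^+ 2 / 8).
  have [ii|ii] := leqP i0 i; last by exists finset.set0.
  move: ii; rewrite geq_max => /andP[ii1 ii2].
  have [||||||Sel SelP] := @missed_selection R n _ (grid_point r i (g := g i)) k
    (rows i) (cols i) (precision i) kap r (s i); last by exists Sel.
  - exact: kap0.
  - by rewrite spacing_gt0 // spacing_le.
  - by rewrite expn_gt0.
  - by move=> j; exact: grid_point_cube.
  - have := prec i ii2; rewrite -/(spacing r (g i) i) -/(s i) -/M -/T => ps.
    have -> : kap * s i ^+ 2 / 8 / M / 2 = s i ^+ 2 * (kap / (16 * M)).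
      by field; rewrite gt_eqF.
    have kM : 0 < kap / (16 * M) by rewrite divr_gt0 // mulr_gt0.
    apply: le_trans (ler_wpM2r (ltW kM) ps).
    have rearrange (a b X K : R) : K != 0 ->
        a * (b / K * X) = a * b * (16 * M / kap) * X / K * (kap / (16 * M)).
      by move=> K0; field; rewrite K0 !gt_eqF.
    rewrite /D -rearrange // pnatr_eq0; by rewrite -lt0n expn_gt0.
  - by rewrite card_ffun !card_ord; exact: count.
pose Sel i := projT1 (cid (sel i)).
(* The origin is there only to make [P] nonempty; it is far from all grids. *)
pose P : set 'rV[R]_N := [set p | p = 0 \/
  exists i, exists2 j, j \in Sel i & p = grid_point r i j].
exists P; split.
- by exists 0; left.
- move=> z [->|[i [j _ ->]]]; last exact: grid_point_cube.
  by move=> l; rewrite mxE normr0 ltW.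
move=> C eps C0 eps0.
have selP i : selects (grid_point r i (g := g i)) (s i) (Sel i) P.
  move=> j; split=> [jS|jS p Pp]; first by right; exists i, j.
  apply: grid_point_far => //; case: Pp => [->|[i' [j' j'S pE]]].
    by constructor 1.
  have [ii'|ii'] := eqVneq i' i; last by constructor 2; exists (g i'), i', j'.
  subst i'; constructor 3; exists j' => //.
  by apply: contraNneq jS => <-.
(* A ninth root, since [geometric_beats_polynomial] concerns ninth powers. *)
pose p : R := 2 `^ (eps / 9%:R).
have p1 : 1 < p.
  have <- : 1 `^ (eps / 9%:R) = 1 :> R by rewrite powR1.
  by rewrite gt0_ltr_powR ?nnegrE ?divr_gt0 // ltr1n.
have pE : p ^+ 9 = 2 `^ eps.
  by rewrite -powR_mulrn ?powR_ge0 // -powRrM divfK ?pnatr_eq0.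
have [i3 beat] := geometric_beats_polynomial (288 * C / (kap * r ^+ 2)) p1.
exists (maxn (2 ^ maxn i0 i3) m1) => // m.
rewrite /mkset geq_max => /andP[im /km kmc] A0 A del sA0 sA appr.
have m0 : (0 < m)%N by apply: leq_trans im; rewrite expn_gt0.
pose i := trunc_log 2 m.
have /andP[im1 im2] : (2 ^ i <= m < 2 ^ i.+1)%N by exact: trunc_log_bounds.
have : (maxn i0 i3 <= i)%N.
  rewrite -ltnS -(ltn_exp2l _ _ (ltnSn 1)); exact: leq_ltn_trans im2.
rewrite geq_max => /andP[ii0 ii3].
have kc : (0 < k m <= cols i)%N.
  rewrite (kdvd m m0).1 /= /cols /blocksize truncn_ge_nat; last first.
    by rewrite mulr_ge0 ?(ltW c0) ?exprn_ge0 ?powR_ge0.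
  apply: le_trans kmc _; rewrite ler_wpM2l ?(ltW c0) // -expn2_powR.
  by rewrite ge0_ler_powR ?nnegrE // ler_nat ltnW.
have /(_ ii0 P) := projT2 (cid (sel i)); rewrite -/(Sel i).
have P0 : P !=set0 by exists 0; left.
move=> /(_ P0 (selP i) m im2 kc A0 A sA0 sA) nappr.
have deli : kap * s i ^+ 2 / 8 <= del.
  rewrite leNgt; apply/negP => lt; apply: nappr.
  exact: approximates_le (ltW lt) appr.
apply: le_trans deli.
have xi0 : 0 < x ^+ i by rewrite exprn_gt0 // powR_gt0.
have qi0 : 0 < (p ^+ 9) ^+ i by rewrite !exprn_gt0 // powR_gt0.
pose e := 2 * (1 + t) / N%:R + eps.
have e0 : 0 <= e by rewrite addr_ge0 ?(ltW eps0) ?divr_ge0 ?mulr_ge0 ?addr_ge0.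
have me : x ^+ i ^+ 2 * (p ^+ 9) ^+ i <= m%:R `^ e.
  have -> : x ^+ i ^+ 2 * (p ^+ 9) ^+ i = (2 ^ i)%:R `^ e.
    rewrite expn2_powR /e powRD ?pnatr_eq0 ?implybT // -pE [RHS]exprMn.
    congr (_ * _); rewrite exprAC; congr (_ ^+ _).
    by rewrite -powR_mulrn ?powR_ge0 // -powRrM mulrC mulrA.
  by rewrite ge0_ler_powR ?nnegrE // ler_nat.
have -> : - (2 * (1 + t) / N%:R) - eps = - e by rewrite /e opprD.
rewrite powRN ler_pdivrMr; last by rewrite powR_gt0 // ltr0n.
apply: le_trans (ler_wpM2l _ me); last first.
  by rewrite divr_ge0 // mulr_ge0 ?(ltW kap0) ?sqr_ge0.
have sl := step_le x1 i r0; rewrite -/(spacing r (g i) i) -/(s i) in sl.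
set A' := 6 * i.+1%:R ^+ 4 * x ^+ i in sl.
have A'0 : 0 < A' by rewrite !mulr_gt0 ?exprn_gt0 ?powR_gt0.
have s2 : (r / A') ^+ 2 <= s i ^+ 2.
  by rewrite lerXn2r ?nnegrE ?divr_ge0 ?(ltW r0) ?(ltW A'0) // ltW // spacing_gt0.
have := beat i ii3; rewrite mulrAC ler_pdivrMr ?mulr_gt0 ?exprn_gt0 // => bt.
have kx : 0 <= kap / 8 * (x ^+ i ^+ 2 * (p ^+ 9) ^+ i).
  apply: mulr_ge0; first by rewrite divr_ge0 // ltW.
  by rewrite mulr_ge0 ?sqr_ge0 // ltW.
apply: (@le_trans _ _ (kap / 8 * (x ^+ i ^+ 2 * (p ^+ 9) ^+ i) * (r / A') ^+ 2)).
  have -> : kap / 8 * (x ^+ i ^+ 2 * (p ^+ 9) ^+ i) * (r / A') ^+ 2 =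
            (p ^+ 9) ^+ i * (kap * r ^+ 2) / (288 * i.+1%:R ^+ 8).
    by rewrite /A'; field; rewrite nat1r pnatr_eq0 /= gt_eqF.
  rewrite ler_pdivlMr ?mulr_gt0 ?exprn_gt0 //.
  by apply: le_trans bt; rewrite le_eqVlt; apply/orP; left; apply/eqP; ring.
apply: le_trans (ler_wpM2l kx s2) _.
by rewrite le_eqVlt; apply/orP; left; apply/eqP; ring.
Qed.

End Construction.

(** * From pencils to functions and bodies *)

Section Transfer.
Context {R : realType}.
Implicit Types (m n : nat).

Lemma enorm_ge0 n (x : 'rV[R]_n) : 0 <= enorm x.
Proof. exact: sqrtr_ge0. Qed.

Lemma enorm_sqr n (x : 'rV[R]_n) : enorm x ^+ 2 = dotrv x x.
Proof. by rewrite sqr_sqrtr // dotrv_ge0. Qed.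

Lemma coord_le_enorm n (x : 'rV[R]_n) i : `|x 0 i| <= enorm x.
Proof. by rewrite -sqrtr_sqr ler_sqrt ?dotrv_ge0 // sqr_coord_le. Qed.

Lemma dotrv_le_enorm n r (z x : 'rV[R]_n) :
  cube r z -> dotrv z x <= n%:R * r * enorm x.
Proof.
move=> zr; apply: (@le_trans _ _ (\sum_(i < n) r * enorm x)); last first.
  by rewrite sumr_const card_ord -(mulr_natl (r * _)) mulrA.
apply: ler_sum => i _; rewrite (le_trans (ler_norm _)) // normrM.
by rewrite ler_pM // coord_le_enorm.
Qed.

Lemma le_supnorm (T : Type) (D : set T) (g : T -> R) (v : R) : D !=set0 ->
  (forall del, (forall x, D x -> `|g x| <= del) -> v <= del) ->
  (v%:E <= supnorm D g)%E.
Proof.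
move=> [x0 Dx0] h.
have ub x : D x -> (`|g x|%:E <= supnorm D g)%E.
  by move=> Dx; apply: ereal_sup_ubound; exists x.
move: ub; case: (supnorm D g) => [del| |] ub; last first.
- by have := ub _ Dx0.
- by rewrite leey.
by rewrite lee_fin; apply: h => x /ub; rewrite lee_fin.
Qed.

Lemma approximates_of n m (A0 : 'M[R]_m) (A : 'I_n -> 'M[R]_m)
    (f F : 'rV[R]_n -> R) r del :
  (forall y a, cube r y -> f y <= a <-> psd_form (a%:M - pencil A0 A y)) ->
  (forall y, cube r y -> `|f y - F y| <= del) ->
  approximates A0 A F r del.
Proof.
move=> fA fF y yr; have := fF y yr; rewrite ler_norml => /andP[lo up].
split=> [|a]; first by apply/(fA _ _ yr); lra.
by move/(fA _ _ yr); lra.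
Qed.

Lemma envelope_lipschitz n kap (P : set 'rV[R]_n) r x y :
  0 <= kap -> P !=set0 -> (forall z, P z -> cube r z) ->
  `|envelope kap P x - envelope kap P y| <= 2 * kap * n%:R * r * enorm (x - y).
Proof.
move=> k0 P0 Pr.
have one u w :
    envelope kap P u - envelope kap P w <= 2 * kap * n%:R * r * enorm (u - w).
  rewrite lerBlDr; apply: envelope_le => // z Pz.
  have := le_envelope w k0 Pz.
  have : 2 * kap * dotrv z (u - w) <= 2 * kap * (n%:R * r * enorm (u - w)).
    by rewrite ler_wpM2l ?mulr_ge0 // dotrv_le_enorm //; exact: Pr.
  rewrite /tangent dotrvBr; lra.
have sym : enorm (y - x) = enorm (x - y).
  by rewrite /enorm -opprB -scaleN1r dotrvZl dotrvZr !mulN1r opprK.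
by have := one x y; have := one y x; rewrite ler_norml sym => ? ?;
   apply/andP; split; lra.
Qed.

Lemma envelope_conv n kap (P : set 'rV[R]_n) x y a b :
  0 <= kap -> P !=set0 -> 0 <= a -> 0 <= b -> a + b = 1 ->
  envelope kap P (a *: x + b *: y) <=
  a * envelope kap P x + b * envelope kap P y.
Proof.
move=> k0 P0 a0 b0 ab; apply: envelope_le => // z Pz.
have -> : tangent kap z (a *: x + b *: y) =
          a * tangent kap z x + b * tangent kap z y.
  rewrite /tangent dotrvDr !dotrvZr.
  by rewrite -[X in _ - X](mul1r (dotrv z z)) -ab; ring.
by rewrite lerD // ler_wpM2l // le_envelope.
Qed.

Lemma hard_convex_function n (L : R) (Omega : set 'rV[R]_n.+1) :
  0 < L -> Omega^° !=set0 ->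
  forall (k : nat -> nat) (c t : R), block_growth k c t ->
  exists2 fstar : 'rV[R]_n.+1 -> R, lipschitz_convex L Omega fstar &
  forall C eps : R, 0 < C -> 0 < eps ->
  \forall m \near \oo,
    ((C * m%:R `^ (- (2 * (1 + t) / n.+1%:R) - eps))%:E <=
     ereal_inf [set supnorm Omega (fun x => f x - fstar x)%R
               | f in spectrahedral m (k m)])%E.
Proof.
move=> L0 [x0 /nbhs_ballP[e e0 ballO]] k c t bg.
pose r := e / 2; have r0 : 0 < r by rewrite divr_gt0.
(* The value that turns [envelope_lipschitz] into the Lipschitz constant [L]. *)
pose kap := L / (2 * n.+1%:R * r).
have kap0 : 0 < kap by rewrite divr_gt0 // !mulr_gt0.
have [P [P0 Pr hard]] := hard_envelope n r0 kap0 bg.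
have cubeO y : cube r y -> Omega (x0 + y).
  move=> yr; apply: ballO; split=> // i j; rewrite ord1 /ball /= mxE.
  rewrite opprD addrA subrr add0r normrN (le_lt_trans (yr j)) // /r.
  by move: e0 => /= e0; lra.
exists (fun x => envelope kap P (x - x0)).
  split=> [w x y _ _|x y _ _]; last first.
    have -> : L = 2 * kap * n.+1%:R * r.
      by rewrite /kap; field; rewrite gt_eqF //= nat1r pnatr_eq0.
    have -> : x - y = (x - x0) - (y - x0) by rewrite opprB addrA subrK.
    exact: envelope_lipschitz (ltW kap0) P0 Pr.
  have w0 : 0 <= w%:inum by [].
  have w1 : 0 <= 1 - w%:inum by rewrite subr_ge0.
  have := envelope_conv (x - x0) (y - x0) (ltW kap0) P0 w0 w1 (subrKC _ _).
  congr (envelope _ _ _ <= _).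
  by rewrite !scalerBr addrACA -opprD -scalerDl subrKC scale1r.
move=> C eps C0 eps0; have := hard C eps C0 eps0.
apply: filterS2 (nbhs_infty_gt 0) => -[//|m] _ hm.
apply: le_ereal_inf_tmp => _ [f [A [B [sA sB fE]]] <-].
apply: le_supnorm => [|del fdel].
  by exists (x0 + 0); apply: cubeO => i; rewrite mxE normr0 ltW.
(* The cube sits at [x0]: translate the pencil there. *)
pose A0 := pencil B A x0.
have sA0 : symblock (k m.+1) A0 by exact: symblock_pencil.
apply: (hm A0 A del sA0 sA).
apply: (@approximates_of _ _ _ _ (fun y => f (x0 + y))) => [y a yr|y yr].
  rewrite fE; have -> : \sum_i (x0 + y) 0 i *: A i + B = pencil A0 A y.
    rewrite /pencil /A0 /pencil addrA -big_split /=; congr (_ + _).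
    by apply: eq_bigr => i _; rewrite mxE scalerDl addrC.
  by apply: lambda_max_le; exact: (symblock_pencil y sA0 sA).1.
by have := fdel _ (cubeO y yr); rewrite addrAC subrr add0r.
Qed.

Lemma dotrv_chart_self n (y : 'rV[R]_n) :
  dotrv (chart y) (chart y) = 1 + dotrv y y.
Proof.
rewrite dotrv_chart mxE unlift_none; congr (_ + _).
by apply: eq_bigr => i _; rewrite mxE liftK.
Qed.

(** The affine functions below the envelope, as vectors of coefficients. Its
    support function is the envelope in the chart, as for the convex hull of the
    points [lifted kap z], but closedness is immediate. *)
Definition minorant_body n (kap Q : R) (P : set 'rV[R]_n) : set 'rV[R]_n.+1 :=
  [set x | cube Q x /\
           forall y, dotrv (chart y) x <= envelope kap P y].

Lemma minorant_body_compact n kap Q (P : set 'rV[R]_n) :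
  compact (minorant_body kap Q P).
Proof.
have cbox : compact [set v : 'rV[R]_n.+1 | forall i, v ord0 i \in `[- Q, Q]].
  apply: (@rV_compact R n.+1 (fun=> `[- Q, Q]%classic)) => i.
  exact: segment_compact.
have -> : minorant_body kap Q P =
    [set v : 'rV[R]_n.+1 | forall i, v ord0 i \in `[- Q, Q]] `&`
    \bigcap_y [set x | dotrv (chart y) x <= envelope kap P y].
  apply/seteqP; split=> [x [xQ xP]|x [xQ xP]]; split.
  - by move=> i; have := xQ i; rewrite ler_norml.
  - by move=> y _; exact: xP.
  - by move=> i; have := xQ i; rewrite /= in_itv /= ler_norml.
  - by move=> y; exact: (xP y).
apply: compact_closedI => //; apply: closed_bigI => y _.
apply: (@preimage_closed _ _ (fun x => dotrv (chart y) x)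
         [set a : R | a <= envelope kap P y]); last exact: closed_le.
move=> x _; apply: (continuous_big add_continuous) => i _ v.
apply: (@continuousM R _ (fun=> chart y 0 i) (fun v : 'rV[R]_n.+1 => v 0 i)).
  exact: cst_continuous.
exact: coord_continuous.
Qed.

Lemma hard_convex_body n (Gamma : R) : 0 < Gamma ->
  forall (k : nat -> nat) (c t : R), block_growth k c t ->
  exists2 Kstar : set 'rV[R]_n.+2, convex_body Gamma Kstar &
  forall C eps : R, 0 < C -> 0 < eps ->
  \forall m \near \oo,
    ((C * m%:R `^ (- (2 * (1 + t) / n.+1%:R) - eps))%:E <=
     ereal_inf [set hausdorff_dist S Kstar
               | S in spectratope m (k m)])%E.
Proof.
move=> G0 k c t bg; pose N := n.+1.
have N0 : 0 < N%:R :> R by [].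
pose Q := Gamma / n.+2%:R; have Q0 : 0 < Q by rewrite divr_gt0.
(* Small enough for all the points [lifted kap z] to be in the cube. *)
pose kap := Q / (2 + N%:R).
have kap0 : 0 < kap by rewrite divr_gt0 // addr_gt0.
have [P [P0 Pr hard]] := hard_envelope n ltr01 kap0 bg.
pose K := minorant_body kap Q P.
have KP z : P z -> K (lifted kap z).
  move=> Pz; split=> [i|y]; last first.
    by rewrite dotrv_chart_lifted le_envelope // ltW.
  have kQ : (2 + N%:R) * kap = Q by rewrite mulrC divfK // gt_eqF // addr_gt0.
  rewrite mxE; case: unlift => [j|].
    rewrite normrM (ger0_norm (mulr_ge0 (ler0n R 2) (ltW kap0))).
    have := Pr z Pz j; have : 0 <= N%:R * kap by rewrite mulr_ge0 // ltW.
    have : 0 <= `|z 0 j| by [].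
    nra.
  rewrite normrN (ger0_norm (mulr_ge0 (ltW kap0) (dotrv_ge0 z))).
  have := dotrv_cube (Pr z Pz); rewrite expr1n mulr1 => dz.
  apply: le_trans (ler_wpM2l (ltW kap0) dz) _.
  by rewrite -kQ mulrC ler_wpM2r ?(ltW kap0) // lerDr.
have K0 : K !=set0 by have [z /KP Kz] := P0; exists (lifted kap z).
exists K.
  split=> //; first exact: minorant_body_compact.
    move=> x y w; rewrite !inE => -[xQ xP] [yQ yP].
    have w0 : 0 <= w%:inum by [].
    have w1 : 0 <= 1 - w%:inum by rewrite subr_ge0.
    change (K (w%:inum *: x + (1 - w%:inum) *: y)); split=> [i|u].
      rewrite !mxE (le_trans (ler_normD _ _)) // !normrM.
      rewrite (ger0_norm w0) (ger0_norm w1).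
      have := ler_wpM2l w0 (xQ i); have := ler_wpM2l w1 (yQ i); lra.
    rewrite dotrvDr !dotrvZr.
    have := ler_wpM2l w0 (xP u); have := ler_wpM2l w1 (yP u); lra.
  move=> x [/dotrv_cube xQ _].
  rewrite -(ger0_norm (ltW G0)) -sqrtr_sqr ler_sqrt ?sqr_ge0 //.
  apply: le_trans xQ _; rewrite /Q expr_div_n mulrCA ler_piMr ?sqr_ge0 //.
  by rewrite expr2 invfM mulrA divff ?pnatr_eq0 // mul1r invf_le1 ?ler1n.
move=> C eps C0 eps0.
(* The chart stretches directions by [rho y <= 2 + N], and errors with them. *)
pose C' := C * (2 + N%:R); have C'0 : 0 < C' by rewrite mulr_gt0 // addr_gt0.
have := hard C' eps C'0 eps0.
apply: filterS2 (nbhs_infty_gt 0) => -[//|m] _ hm.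
apply: le_ereal_inf_tmp => _ [S /spectratope_pencil[A0 [A [sA0 sA SA]]] <-].
apply: le_supnorm => [|del Sdel].
  exists (delta_mx 0 0); rewrite /esphere /= /enorm dotrv_delta mxE !eqxx.
  exact: sqrtr1.
have /(hm A0 A _ sA0 sA) :
    approximates A0 A (envelope kap P) 1 ((2 + N%:R) * del).
  pose rho y : R := enorm (chart y : 'rV[R]_N.+1).
  have rho2 y : rho y ^+ 2 = 1 + dotrv y y.
    by rewrite enorm_sqr dotrv_chart_self.
  have rho0 y : 0 < rho y.
    rewrite lt_neqAle enorm_ge0 andbT eq_sym -sqrf_eq0 rho2 gt_eqF //.
    by rewrite ltr_wpDr // dotrv_ge0.
  have hK y :
      rho y * support_function K ((rho y)^-1 *: chart y) = envelope kap P y.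
    apply/eqP; rewrite eq_le; apply/andP; split.
      rewrite -ler_pdivlMl //; apply: ge_sup => [|_ [x [_ xP] <-]].
        exact: image_nonempty.
      by rewrite dotrvZl ler_wpM2l ?invr_ge0 ?(ltW (rho0 y)).
    apply: envelope_le => // z Pz; rewrite -ler_pdivrMl //.
    apply: ub_le_sup.
      exists ((rho y)^-1 * envelope kap P y) => _ [x [_ xP] <-].
      by rewrite dotrvZl ler_wpM2l ?invr_ge0 ?(ltW (rho0 y)).
    exists (lifted kap z); first exact: KP.
    by rewrite dotrvZl dotrv_chart_lifted.
  apply: (@approximates_of _ _ _ _
      (fun y => rho y * support_function S ((rho y)^-1 *: chart y))).
    by move=> y a _; exact: SA.
  move=> y y1; rewrite -hK -mulrBr normrM (ger0_norm (ltW (rho0 y))).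
  have rhoN : rho y <= 2 + N%:R.
    have := dotrv_cube y1; rewrite expr1n mulr1 => yN.
    rewrite -(@ler_pXn2r _ 2) ?nnegrE ?(ltW (rho0 y)) ?addr_ge0 // rho2.
    have := sqr_ge0 (N%:R : R); rewrite sqrrD => ?; lra.
  rewrite ler_pM ?(ltW (rho0 y)) //; apply: Sdel.
  rewrite /esphere /= /enorm dotrvZl dotrvZr -enorm_sqr -/(rho y).
  by rewrite mulrA -expr2 -exprMn mulVf ?gt_eqF // expr1n sqrtr1.
by rewrite /C' -mulrA mulrCA ler_pM2l.
Qed.

End Transfer.

Theorem theorem8 (R : realType) (d : nat) :
  ((0 < d)%N ->
   forall (L : R) (Omega : set 'rV[R]_d),
   0 < L -> compact Omega -> convex_set Omega -> Omega^° !=set0 ->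
   exists2 C : R, 0 < C &
   forall (k : nat -> nat) (c t : R), block_growth k c t ->
   exists2 fstar : 'rV[R]_d -> R, lipschitz_convex L Omega fstar &
   forall eps : R, 0 < eps ->
   \forall m \near \oo,
     ((C * m%:R `^ (- (2 * (1 + t) / d%:R) - eps))%:E <=
      ereal_inf [set supnorm Omega (fun x => f x - fstar x)%R
                | f in spectrahedral m (k m)])%E)
  /\
  ((1 < d)%N ->
   forall Gamma : R, 0 < Gamma ->
   exists2 C : R, 0 < C &
   forall (k : nat -> nat) (c t : R), block_growth k c t ->
   exists2 Kstar : set 'rV[R]_d, convex_body Gamma Kstar &
   forall eps : R, 0 < eps ->
   \forall m \near \oo,
     ((C * m%:R `^ (- (2 * (1 + t) / (d.-1)%:R) - eps))%:E <=
      ereal_inf [set hausdorff_dist S Kstar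
                | S in spectratope m (k m)])%E).
Proof.
split.
  case: d => [//|n] _ L Omega L0 _ _ Omega0; exists 1 => // k c t bg.
  have [f fL hard] := hard_convex_function L0 Omega0 bg.
  by exists f => // eps; exact: hard.
case: d => [//|[//|n]] _ Gamma G0; exists 1 => // k c t bg.
have [K KG hard] := hard_convex_body n G0 bg.
by exists K => // eps; exact: hard.
Qed.
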